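(* The Menelaus system is decidable: there is an algorithm which, given any sequent $\vdash\Gamma$ of the Menelaus system, decides whether $\vdash\Gamma$ is derivable in it.
   Context: **$\Delta$-complexes.** A $\Delta$-complex $K$ consists of mutually disjoint sets $K_0,K_1,\ldots$ (elements of $K_n$ are $n$-cells) and functions (faces) $d^n_i\colon K_n\to K_{n-1}$, $n\ge 1$, $0\le i\le n$, with $d^{n-1}_j\circ d^n_l=d^{n-1}_{l-1}\circ d^n_j$ whenever $l-1\ge j$; superscripts are often omitted. $C_n$ is the free abelian group on $K_n$ and $\partial_n\colon C_n\to C_{n-1}$ is given by $\partial_n x=\sum_{i=0}^n(-1)^id_ix$. A face of a 2-cell is an *edge* of it; a face of an edge of a 2-cell is a *vertex* of that 2-cell; a face of a 1-cell is a *vertex* of it. A $\Delta$-complex is connected when any two distinct 0-cells are joined by a sequence of 0-cells in which any two consecutive ones are the pair of vertices of a 1-cell. Two 2-cells are *$w$-neighbours* ($w$ a 0-cell) when they share an edge having $w$ as a vertex. **$\mathcal M$-complexes.** An $\mathcal M$-complex is a connected $\Delta$-complex $L$ such that: (0) $L$ has finitely many cells; (1) $L_m=\emptyset$ for $m\ge3$, every 0-cell is a face of some 1-cell and every 1-cell is a face of some 2-cell; (2) two different faces map an element of $L_2$ (resp. $L_1$) to two different elements of $L_1$ (resp. $L_0$); (3) every 1-cell is an edge of exactly two 2-cells; (4) for every $w\in L_0$, any two elements of $L_w=\{u\in L_2\mid w \text{ is a vertex of }u\}$ are joined by a sequence of 2-cells in which consecutive ones are $w$-neighbours; (5) $H_2(L;\mathbf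 Z)=\mathrm{Ker}\,\partial_2\cong\mathbf Z$. **The Menelaus system.** Let $\mathcal W$ be a countable set (the alphabet). Atomic formulae are the sextuples of pairwise distinct elements of $\mathcal W$; the set of these is $F^6(\mathcal W)$. Formulae are built from atomic ones with two binary connectives $\diamond$ and $\leftrightarrow$. A sequent $\vdash\Gamma$ is a finite multiset $\Gamma$ of formulae. Axiomatic sequents: (i) for every $\mathcal M$-complex $L$ with $L_0\cup L_1\subseteq\mathcal W$, the sequent $\vdash\{\nu x\mid x\in L_2\}$ (a multiset indexed by $L_2$), where $\nu x=(d_1d_2x,d_0d_2x,d_0d_0x,d_0x,d_1x,d_2x)$; (ii) $\vdash(A,B,C,P,Q,R),(B,C,A,Q,R,P)$ and $\vdash(A,B,C,P,Q,R),(A,R,Q,P,C,B)$ for all $(A,B,C,P,Q,R)\in F^6(\mathcal W)$. Rules: cut: from $\vdash\Gamma,\varphi$ and $\vdash\Delta,\varphi$ infer $\vdash\Gamma,\Delta$; cut with empty cut formula: from $\vdash\Gamma$ and $\vdash\Delta$ infer $\vdash\Gamma,\Delta$; $\diamond$-introduction: from $\vdash\Gamma,\varphi$ and $\vdash\Gamma,\psi$ infer $\vdash\Gamma,\varphi\diamond\psi$; $\leftrightarrow$-introduction: from $\vdash\Gamma,\varphi$ and $\vdash\Delta,\psi$ infer $\vdash\Gamma,\Delta,\varphi\leftrightarrow\psi$. *)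

(* Defs.v *)
From HB Require Import structures.
From mathcomp Require Import all_boot all_order all_algebra.
From mathcomp Require Import finmap multiset.
From mathcomp.multinomials Require Import freeg.
From Stdlib Require Import Relation_Operators.
From Stdlib Require Cantor.

Set Implicit Arguments.
Unset Strict Implicit.
Unset Printing Implicit Defensive.

Local Open Scope ring_scope.

Declare Scope delta_scope.
Local Open Scope delta_scope.

(* The n-cells form a type of their own for each n, so cells of different
   dimensions are automatically distinct. With j : 'I_n.+2 and l : 'I_n.+2,
   [widen_ord _ j] has value j and [fintype.lift ord0 l] has value l + 1, so the law
   below is d_j (d_(l+1) x) = d_l (d_j x) for j <= l. *)
Record delta_complex := DeltaComplex {
  cell : nat -> choiceType;
  face : forall n, 'I_n.+2 -> cell n.+1 -> cell n;
  faceP : forall n (j l : 'I_n.+2) (x : cell n.+2), (j <= l)%N ->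
    face j (face (fintype.lift ord0 l) x) = face l (face (widen_ord (leqnSn _) j) x)
}.

Arguments face _ {n} _ _.
Arguments faceP _ {n} _ _ _ _.

Notation "''d_' i" := (face _ (@inord _ i%N))
  (at level 8, i at level 2, format "''d_' i") : delta_scope.

Section DeltaComplex.
Variable K : delta_complex.

Definition chain n := {freeg (cell K n) / int}.

Definition boundary n : chain n.+1 -> chain n :=
  fglift (fun x => \sum_(i < n.+2) (-1) ^+ i *: (<< face K i x >> : chain n)).

Definition is_face n (y : cell K n) (x : cell K n.+1) : Prop :=
  exists i, face K i x = y.

Definition is_vertex2 (w : cell K 0) (u : cell K 2) : Prop :=
  exists2 e : cell K 1, is_face e u & is_face w e.

Definition adjacent0 (v w : cell K 0) : Prop :=
  exists e : cell K 1,
    ('d_0 e = v /\ 'd_1 e = w) \/ ('d_0 e = w /\ 'd_1 e = v).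

Definition connected : Prop :=
  forall v w : cell K 0, v <> w -> clos_refl_trans _ adjacent0 v w.

Definition neighbours (w : cell K 0) (u u' : cell K 2) : Prop :=
  exists e : cell K 1, [/\ is_face w e, is_face e u & is_face e u'].

Record M_complex : Prop := MComplex {
  M_connected : connected;
  M_finite : exists s : seq {n : nat & cell K n}, forall c, c \in s;
  M_dim2 : forall m, (3 <= m)%N -> cell K m -> False;
  M_cell0 : forall v : cell K 0, exists e : cell K 1, is_face v e;
  M_cell1 : forall e : cell K 1, exists u : cell K 2, is_face e u;
  M_face2_inj : forall u : cell K 2, injective (fun i => face K i u);
  M_face1_inj : forall e : cell K 1, injective (fun i => face K i e);
  M_two_sides : forall e : cell K 1, exists u1 u2 : cell K 2,
    u1 <> u2 /\ forall u, is_face e u <-> u = u1 \/ u = u2;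
  M_link : forall (w : cell K 0) (u u' : cell K 2),
    is_vertex2 w u -> is_vertex2 w u' -> clos_refl_trans _ (neighbours w) u u';
  (* a group isomorphism from Z onto Ker boundary_2 (which is H_2, as there
     are no 3-cells) *)
  M_H2 : exists2 g : {additive int -> chain 2}, injective g &
    forall c : chain 2, boundary c = 0 <-> exists z, c = g z
}.

End DeltaComplex.

Definition sextuple (W : countType) := {t : 6.-tuple W | uniq t}.

Definition Sextuple (W : countType) (A B C P Q R : W)
    (h : uniq [:: A; B; C; P; Q; R]) : sextuple W :=
  exist _ [tuple A; B; C; P; Q; R] h.

Inductive formula (W : countType) : Type :=
| Atom of sextuple W
| Dia of formula W & formula W
| Iff of formula W & formula W.

Section FormulaCountable.
Variable W : countType.

Fixpoint formula_tree (p : formula W) : GenTree.tree (sextuple W) :=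
  match p with
  | Atom t => GenTree.Leaf t
  | Dia p q => GenTree.Node 0 [:: formula_tree p; formula_tree q]
  | Iff p q => GenTree.Node 1 [:: formula_tree p; formula_tree q]
  end.

Fixpoint tree_formula (t : GenTree.tree (sextuple W)) : option (formula W) :=
  match t with
  | GenTree.Leaf t => Some (Atom t)
  | GenTree.Node 0 [:: a; b] =>
      if (tree_formula a, tree_formula b) is (Some p, Some q)
      then Some (Dia p q) else None
  | GenTree.Node 1 [:: a; b] =>
      if (tree_formula a, tree_formula b) is (Some p, Some q)
      then Some (Iff p q) else None
  | _ => None
  end.

Lemma formula_treeK : pcancel formula_tree tree_formula.
Proof. by elim=> //= p -> q ->. Qed.

HB.instance Definition _ :=
  Countable.copy (formula W) (pcan_type formula_treeK).

End FormulaCountable.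

(* The condition that L_0 and L_1 are disjoint subsets of the alphabet is
   rendered by an injective labelling of the 0-cells and 1-cells by letters. *)
Section Nu.
Variables (W : countType) (L : delta_complex).
Variable lab : cell L 0 + cell L 1 -> W.
Local Notation vl v := (lab (inl v)).
Local Notation el e := (lab (inr e)).

Definition nu_seq (x : cell L 2) : seq W :=
  [:: vl ('d_1 ('d_2 x)); vl ('d_0 ('d_2 x)); vl ('d_0 ('d_0 x));
      el ('d_0 x); el ('d_1 x); el ('d_2 x)].

Lemma nu_uniq (x : cell L 2) :
  M_complex L -> injective lab -> uniq (nu_seq x).
Proof.
move=> ML inj.
have e2 (i j : nat) : (i < 3)%N -> (j < 3)%N -> i != j ->
    ('d_i x : cell L 1) != 'd_j x.
  move=> hi hj; apply: contraNneq => /(M_face2_inj ML)/(congr1 val).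
  by rewrite /= !inordK // => ->.
have e1 (e : cell L 1) : ('d_0 e : cell L 0) != 'd_1 e.
  by apply/eqP => /(M_face1_inj ML)/(congr1 val); rewrite /= !inordK.
have sim (j l : nat) : (j <= l)%N -> (l < 2)%N ->
    ('d_j ('d_l.+1 x) : cell L 0) = 'd_l ('d_j x).
  move=> jl l2; have j2 := leq_ltn_trans jl l2.
  have := @faceP L 0 (inord j) (inord l) x; rewrite !inordK // => /(_ jl).
  have -> : fintype.lift ord0 (inord l : 'I_2) = inord l.+1.
    by apply: val_inj; rewrite /= /bump /= !inordK.
  have -> // : widen_ord (leqnSn _) (inord j : 'I_2) = inord j.
  by apply: val_inj; rewrite /= !inordK // ltnW.
have n01 : 'd_1 ('d_2 x) != 'd_0 ('d_2 x) :> cell L 0 by rewrite eq_sym e1.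
have n12 : 'd_0 ('d_2 x) != 'd_0 ('d_0 x) :> cell L 0.
  by rewrite (sim 0 1)%N // eq_sym e1.
have n02 : 'd_1 ('d_2 x) != 'd_0 ('d_0 x) :> cell L 0.
  by rewrite (sim 1 1)%N // -(sim 0 0)%N // eq_sym e1.
rewrite /nu_seq -/(map lab [:: inl _; inl _; inl _; inr _; inr _; inr _]).
rewrite (map_inj_uniq inj) /= !inE !negb_or.
rewrite !(inj_eq (@inl_inj _ _)) !(inj_eq (@inr_inj _ _)).
by rewrite n01 n12 n02 !e2.
Qed.

Definition nu (ML : M_complex L) (inj : injective lab) (x : cell L 2) :
    sextuple W :=
  Sextuple (nu_uniq x ML inj).

End Nu.

Local Open Scope mset_scope.

Inductive derivable (W : countType) : {mset formula W} -> Prop :=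
| ax_complex (L : delta_complex) (lab : cell L 0 + cell L 1 -> W)
    (ML : M_complex L) (inj : injective lab) (L2 : seq (cell L 2)) :
    uniq L2 -> (forall x, x \in L2) ->
    derivable (seq_mset [seq Atom (nu ML inj x) | x <- L2])
| ax_cycle (A B C P Q R : W) (h : uniq [:: A; B; C; P; Q; R])
    (h' : uniq [:: B; C; A; Q; R; P]) :
    derivable ([mset Atom (Sextuple h)] `+` [mset Atom (Sextuple h')])
| ax_swap (A B C P Q R : W) (h : uniq [:: A; B; C; P; Q; R])
    (h' : uniq [:: A; R; Q; P; C; B]) :
    derivable ([mset Atom (Sextuple h)] `+` [mset Atom (Sextuple h')])
| cut (G D : {mset formula W}) (p : formula W) :
    derivable (p +` G) -> derivable (p +` D) -> derivable (G `+` D)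
| cut_empty (G D : {mset formula W}) :
    derivable G -> derivable D -> derivable (G `+` D)
| dia_intro (G : {mset formula W}) (p q : formula W) :
    derivable (p +` G) -> derivable (q +` G) -> derivable (Dia p q +` G)
| iff_intro (G D : {mset formula W}) (p q : formula W) :
    derivable (p +` G) -> derivable (q +` D) ->
    derivable (Iff p q +` (G `+` D)).

Local Open Scope nat_scope.

(* Total recursive functions, presented on nat with Cantor's pairing standing
   for tuples of arguments. By Kleene's normal form theorem, restricting
   minimisation to regular functions (where the search always succeeds) loses
   no total recursive function. *)
Definition pairn (a b : nat) : nat := Cantor.to_nat (a, b).
Definition fstn (n : nat) : nat := (Cantor.of_nat n).1.
Definition sndn (n : nat) : nat := (Cantor.of_nat n).2.

Inductive recursive : (nat -> nat) -> Prop :=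
| rec_zero : recursive (fun _ => 0)
| rec_succ : recursive S
| rec_fst : recursive fstn
| rec_snd : recursive sndn
| rec_pair f g : recursive f -> recursive g ->
    recursive (fun n => pairn (f n) (g n))
| rec_comp f g : recursive f -> recursive g -> recursive (fun n => f (g n))
| rec_prim f g : recursive f -> recursive g ->
    recursive (fun n =>
      nat_rect (fun _ => nat) (f (fstn n))
        (fun k r => g (pairn (fstn n) (pairn k r))) (sndn n))
| rec_min f h : recursive f ->
    (forall n, f (pairn n (h n)) = 0 /\
               forall m, m < h n -> f (pairn n m) <> 0) ->
    recursive h.

Fixpoint code_seq (s : seq nat) : nat :=
  if s is a :: s' then (pairn a (code_seq s')).+1 else 0.

Fixpoint code_formula (W : countType) (p : formula W) : nat :=
  match p with
  | Atom t => pairn 0 (code_seq [seq choice.pickle a | a <- tval (val t)])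
  | Dia p q => pairn 1 (pairn (code_formula p) (code_formula q))
  | Iff p q => pairn 2 (pairn (code_formula p) (code_formula q))
  end.

(* A sequent is given to an algorithm as any list of its formulae. *)
Definition code_sequent (W : countType) (s : seq (formula W)) : nat :=
  code_seq [seq code_formula p | p <- s].

(* Main.v *)
(* Cuts on compound formulae can be eliminated, since their only rules are the
   introductions, which can be undone against each other. In a derivation with
   atomic cuts only, a letter never occurs in exactly one formula of a sequent:
   in a closed surface every edge and every vertex lies on at least two
   triangles, and the rules preserve the property. Hence both premises of a cut
   have all their letters in the conclusion and are at most as long as it, so
   that a derivation of a sequent stays within the finite set of sequents of
   bounded length formed from its subformulae and the atoms on its letters; the
   derivable ones among them are found by saturation. The axioms (i) are
   recognised by a test on the incidence table of the triangles. There, given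
   that the surface is connected and each edge has two sides, the kernel of the
   boundary map is infinite cyclic exactly when the triangles can be oriented
   coherently, and connectedness and orientability are tested by running through
   the two-colourings of the set of triangles. *)

Require Import Defs.
From HB Require Import structures.
From mathcomp Require Import all_boot all_order all_algebra.
From mathcomp Require Import finmap multiset zify.
From mathcomp.multinomials Require Import freeg.
From Stdlib Require Import Relation_Operators ClassicalEpsilon.

Set Implicit Arguments.
Unset Strict Implicit.
Unset Printing Implicit Defensive.

(** * Computable functions between encoded types *)

(** The obstacle is the cut: an atomic cut formula could bring in unlimited new letters, and the
    premises could be longer than the conclusion. Since each letter of the cut atom must recur in
    both contexts, no new letter appears; and since a sextuple has letters at all, both contexts
    $\Gamma$ and $\Delta$ are nonempty, so that $1+|\Gamma|$ and $1+|\Delta|$ are at most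
    $|\Gamma|+|\Delta|$. For a 2-cycle, the coefficients at the two sides of an edge agree up to
    sign. By connectedness all coefficients then have the same absolute value, the signs of a
    nonzero cycle form an orientation, and conversely an orientation gives a cycle of which all
    others are multiples. Two-colourings replace the search for paths: triangles are linked by a
    relation exactly when every colouring that is constant along it is constant. This form is a
    finite test, and it can be applied to any set of triangles that a proof singles out. *)

Lemma fstnK a b : fstn (pairn a b) = a.
Proof. by rewrite /fstn /pairn Cantor.cancel_of_to. Qed.

Lemma sndnK a b : sndn (pairn a b) = b.
Proof. by rewrite /sndn /pairn Cantor.cancel_of_to. Qed.

Lemma pairn_fst_snd n : pairn (fstn n) (sndn n) = n.
Proof.
by rewrite /pairn /fstn /sndn -surjective_pairing Cantor.cancel_to_of.
Qed.

Lemma leq_pairn a b : a + b <= pairn a b.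
Proof.
apply/leP; have := Cantor.to_nat_non_decreasing a b.
by rewrite PeanoNat.Nat.add_comm.
Qed.

Lemma pairn_inj a b c d : pairn a b = pairn c d -> a = c /\ b = d.
Proof.
by move=> e; move: (congr1 fstn e) (congr1 sndn e); rewrite !fstnK !sndnK.
Qed.

Class encodable (T : Type) := Encodable { enc : T -> nat; enc_inj : injective enc }.

#[export] Instance encodable_nat : encodable nat := @Encodable _ id (@inj_id _).

#[export] Instance encodable_bool : encodable bool.
Proof. by apply: (@Encodable _ nat_of_bool) => -[] []. Defined.

#[export] Instance encodable_prod S T `{encodable S} `{encodable T} :
  encodable (S * T).
Proof.
apply: (@Encodable _ (fun x => pairn (enc x.1) (enc x.2))) => -[a b] [c d] /=.
by move=> /pairn_inj[/(@enc_inj S _) -> /(@enc_inj T _) ->].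
Defined.

Lemma code_seq_inj : injective code_seq.
Proof.
by elim=> [|a s IH] [|b t] //= [] /pairn_inj [-> /IH ->].
Qed.

#[export] Instance encodable_seq T `{encodable T} : encodable (seq T).
Proof.
apply: (@Encodable _ (fun s => code_seq (map enc s))).
by move=> s t /code_seq_inj /(inj_map (@enc_inj T _)).
Defined.

(** Only the values at codes are constrained, so a realising function never has to recognise whether
    a number is a code. *)
Definition computable S T `{encodable S} `{encodable T} (f : S -> T) : Prop :=
  exists2 g, recursive g & forall x, g (enc x) = enc (f x).

Section Combinators.
Context X `{encodable X}.

Lemma computable_ext T `{encodable T} (f g : X -> T) :
  f =1 g -> computable f -> computable g.
Proof. by move=> e [h rh hh]; exists h => // x; rewrite hh e. Qed.

Lemma computable_comp S T `{encodable S} `{encodable T} (f : S -> T) (g : X -> S) :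
  computable f -> computable g -> computable (fun x => f (g x)).
Proof.
move=> [f' rf hf] [g' rg hg]; exists (fun n => f' (g' n)); first exact: rec_comp.
by move=> x; rewrite hg hf.
Qed.

Lemma computable_id : computable (fun x : X => x).
Proof.
(* [recursive] has no identity among its constructors; pairing the two projections supplies it. *)
exists (fun n => pairn (fstn n) (sndn n)); first exact: rec_pair rec_fst rec_snd.
by move=> x; rewrite pairn_fst_snd.
Qed.

Lemma computable_const T `{encodable T} (c : T) : computable (fun _ : X => c).
Proof.
exists (fun _ => enc c) => //; elim: (enc c) => [|n IH]; first exact: rec_zero.
exact: (rec_comp rec_succ IH).
Qed.

Lemma computable_pair S T `{encodable S} `{encodable T} (f : X -> S) (g : X -> T) :
  computable f -> computable g -> computable (fun x => (f x, g x)).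
Proof.
move=> [f' rf hf] [g' rg hg]; exists (fun n => pairn (f' n) (g' n)).
  exact: rec_pair.
by move=> x; rewrite hf hg.
Qed.

Lemma computable_fst S T `{encodable S} `{encodable T} (f : X -> S * T) :
  computable f -> computable (fun x => (f x).1).
Proof.
move=> [f' rf hf]; exists (fun n => fstn (f' n)); first exact: rec_comp rec_fst rf.
by move=> x; rewrite hf fstnK.
Qed.

Lemma computable_snd S T `{encodable S} `{encodable T} (f : X -> S * T) :
  computable f -> computable (fun x => (f x).2).
Proof.
move=> [f' rf hf]; exists (fun n => sndn (f' n)); first exact: rec_comp rec_snd rf.
by move=> x; rewrite hf sndnK.
Qed.

Lemma computable_succ (f : X -> nat) :
  computable f -> computable (fun x => (f x).+1).
Proof.
move=> [f' rf hf]; exists (fun n => (f' n).+1); first exact: rec_comp rec_succ rf.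
by move=> x; rewrite hf.
Qed.

Lemma computable_pairn (f g : X -> nat) :
  computable f -> computable g -> computable (fun x => pairn (f x) (g x)).
Proof.
move=> [f' rf hf] [g' rg hg]; exists (fun n => pairn (f' n) (g' n)).
  exact: rec_pair.
by move=> x; rewrite hf hg.
Qed.

Lemma computable_fstn (f : X -> nat) :
  computable f -> computable (fun x => fstn (f x)).
Proof.
move=> [f' rf hf]; exists (fun n => fstn (f' n)); first exact: rec_comp rec_fst rf.
by move=> x; rewrite hf.
Qed.

Lemma computable_sndn (f : X -> nat) :
  computable f -> computable (fun x => sndn (f x)).
Proof.
move=> [f' rf hf]; exists (fun n => sndn (f' n)); first exact: rec_comp rec_snd rf.
by move=> x; rewrite hf.
Qed.

Lemma computable_nat_rect T `{encodable T} (n : X -> nat) (f : X -> T)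
    (g : X -> nat -> T -> T) :
  computable n -> computable f -> computable (fun z : X * (nat * T) => g z.1 z.2.1 z.2.2) ->
  computable (fun x => nat_rect (fun _ => T) (f x) (g x) (n x)).
Proof.
move=> [n' rn hn] [f' rf hf] [g' rg hg].
pose h m := nat_rect (fun _ => nat) (f' (fstn m))
  (fun k r => g' (pairn (fstn m) (pairn k r))) (sndn m).
have rh : recursive h by apply: rec_prim.
have [i' ri hi] := computable_id.
exists (fun m => h (pairn (i' m) (n' m))); first exact: rec_comp rh (rec_pair ri rn).
move=> x; rewrite hi hn /h fstnK sndnK.
change (enc (n x)) with (n x); elim: (n x) => [|k IH] /=; first exact: hf.
by rewrite {}IH; apply: (hg (x, (k, _))).
Qed.

End Combinators.

Lemma computable_proj1 S T `{encodable S} `{encodable T} : computable (@fst S T).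
Proof. exact (computable_fst (@computable_id (S * T) _)). Qed.

Lemma computable_proj2 S T `{encodable S} `{encodable T} : computable (@snd S T).
Proof. exact (computable_snd (@computable_id (S * T) _)). Qed.

(* Matching on the syntax of the body keeps unification from unfolding it. *)
Ltac computable_basic :=
  lazymatch goal with
  | |- computable (fun x => x) => exact: computable_id
  | |- computable (fun _ => ?c) => exact: computable_const
  | |- computable fst => exact: computable_proj1
  | |- computable snd => exact: computable_proj2
  | |- computable (fun x => (_, _)) => apply: computable_pair
  | |- computable (fun x => fst _) => apply: computable_fst
  | |- computable (fun x => snd _) => apply: computable_snd
  | |- computable (fun x => S _) => apply: computable_succ
  | |- computable (fun x => pairn _ _) => apply: computable_pairn
  | |- computable (fun x => fstn _) => apply: computable_fstn
  | |- computable (fun x => sndn _) => apply: computable_sndn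
  end.
Ltac computable_step := computable_basic.
Ltac computable_var :=
  match goal with
  | ch : computable ?h |- computable (fun x => ?h (@?g x)) =>
      refine (computable_comp ch (g := g) _)
  | ch : computable (fun y => ?h (fst y) (snd y))
      |- computable (fun x => ?h (@?a x) (@?b x)) =>
      refine (computable_comp ch (g := fun x => (a x, b x)) _)
  end.
Ltac comp :=
  repeat (progress (cbn beta) || computable_step || assumption || computable_var).

(** * Arithmetic and boolean operations *)

Section Nat.
Context X `{encodable X}.

Lemma computable_nat_case T `{encodable T} (n : X -> nat) (f : X -> T)
    (g : X -> nat -> T) :
  computable n -> computable f -> computable (fun z : X * nat => g z.1 z.2) ->
  computable (fun x => if n x is k.+1 then g x k else f x).
Proof.
move=> cn cf cg.
apply: (computable_ext (f := fun x =>
  nat_rect (fun _ => T) (f x) (fun k _ => g x k) (n x))); first by move=> x; case: (n x).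
apply: (computable_nat_rect (g := fun x k _ => g x k)) => //.
by comp.
Qed.

Lemma computable_iter T `{encodable T} (n : X -> nat) (f : X -> T) (g : X -> T -> T) :
  computable n -> computable f -> computable (fun z : X * T => g z.1 z.2) ->
  computable (fun x => iter (n x) (g x) (f x)).
Proof.
move=> cn cf cg.
apply: (computable_ext (f := fun x =>
  nat_rect (fun _ => T) (f x) (fun _ => g x) (n x))).
  by move=> x; elim: (n x) => //= k ->.
apply: (computable_nat_rect (g := fun x _ => g x)) => //.
by comp.
Qed.

Lemma computable_if T `{encodable T} (b : X -> bool) (f g : X -> T) :
  computable b -> computable f -> computable g ->
  computable (fun x => if b x then f x else g x).
Proof.
move=> [b' rb hb] cf cg.
have cb : computable (fun x => nat_of_bool (b x)) by exists b'.
apply: (computable_ext (f := fun x => if nat_of_bool (b x) is _.+1 then f x else g x)).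
  by move=> x; case: (b x).
by apply: computable_nat_case => //; comp.
Qed.

Lemma computable_andb (f g : X -> bool) :
  computable f -> computable g -> computable (fun x => f x && g x).
Proof. by move=> cf cg; apply: computable_if => //; apply: computable_const. Qed.

Lemma computable_orb (f g : X -> bool) :
  computable f -> computable g -> computable (fun x => f x || g x).
Proof. by move=> cf cg; apply: computable_if => //; apply: computable_const. Qed.

Lemma computable_implb (f g : X -> bool) :
  computable f -> computable g -> computable (fun x => f x ==> g x).
Proof. by move=> cf cg; apply: computable_if => //; apply: computable_const. Qed.

Lemma computable_negb (f : X -> bool) :
  computable f -> computable (fun x => ~~ f x).
Proof. by move=> cf; apply: computable_if => //; apply: computable_const. Qed.

Lemma computable_addb (f g : X -> bool) :
  computable f -> computable g -> computable (fun x => f x (+) g x).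
Proof.
move=> cf cg; apply: computable_ext (computable_if cf (computable_negb cg) cg).
by move=> x; case: (f x).
Qed.

Lemma computable_addn (f g : X -> nat) :
  computable f -> computable g -> computable (fun x => f x + g x).
Proof.
move=> cf cg; apply: (computable_ext (f := fun x => iter (g x) S (f x))).
  by move=> x; elim: (g x) => [|k IH] /=; rewrite ?addn0 // IH addnS.
by apply: (computable_iter (g := fun=> S)) => //; comp.
Qed.

Lemma computable_pred (f : X -> nat) :
  computable f -> computable (fun x => (f x).-1).
Proof.
move=> cf; apply: (computable_ext (f := fun x => if f x is k.+1 then k else 0)).
  by move=> x; case: (f x).
exact (computable_nat_case (g := fun _ k => k) cf (computable_const 0)
  (@computable_proj2 X nat _ _)).
Qed.

End Nat.

Lemma computable_subn X `{encodable X} (f g : X -> nat) :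
  computable f -> computable g -> computable (fun x => f x - g x).
Proof.
move=> cf cg; apply: (computable_ext (f := fun x => iter (g x) predn (f x))).
  by move=> x; elim: (g x) => [|k IH] /=; rewrite ?subn0 // IH subnS.
by apply: (computable_iter (g := fun=> predn)) => //; apply: computable_pred; comp.
Qed.

Lemma computable_eqn X `{encodable X} (f g : X -> nat) :
  computable f -> computable g -> computable (fun x => f x == g x).
Proof.
move=> cf cg.
apply: (computable_ext
  (f := fun x => if (f x - g x) + (g x - f x) is _.+1 then false else true)).
  move=> x; rewrite eqn_leq /leq.
  by case: (f x - g x) => //; case: (g x - f x).
by apply: (computable_nat_case (g := fun _ _ => false));
  [apply: computable_addn; apply: computable_subn | | ]; comp.
Qed.

Section Eq.
Context X `{encodable X}.

Lemma computable_eq (T : eqType) `{encodable T} (f g : X -> T) :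
  computable f -> computable g -> computable (fun x => f x == g x).
Proof.
move=> [f' rf hf] [g' rg hg].
have cf : computable (fun x => enc (f x)) by exists f'.
have cg : computable (fun x => enc (g x)) by exists g'.
apply: (computable_ext (f := fun x => enc (f x) == enc (g x))).
  by move=> x; rewrite (inj_eq enc_inj).
exact: computable_eqn.
Qed.

End Eq.

Ltac computable_nat :=
  lazymatch goal with
  | |- computable (fun x => if _ then _ else _) => apply: computable_if
  | |- computable (fun x => _ && _) => apply: computable_andb
  | |- computable (fun x => _ || _) => apply: computable_orb
  | |- computable (fun x => _ ==> _) => apply: computable_implb
  | |- computable (fun x => ~~ _) => apply: computable_negb
  | |- computable (fun x => _ (+) _) => apply: computable_addb
  | |- computable (fun x => _ .-1) => apply: computable_pred
  | |- computable (fun x => _ + _) => apply: computable_addn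
  | |- computable (fun x => _ - _) => apply: computable_subn
  | |- computable (fun x => _ == _) => apply: computable_eq
  | _ => computable_basic
  end.
Ltac computable_step ::= computable_nat.

(** * Operations on lists *)

Section Seq.
Context X `{encodable X} S `{encodable S} T `{encodable T}.

Lemma computable_cons (a : X -> S) (s : X -> seq S) :
  computable a -> computable s -> computable (fun x => a x :: s x).
Proof.
move=> ca [s' rs hs].
have cs : computable (fun x => enc (s x)) by exists s'.
have [a' ra ha] := ca.
have ca' : computable (fun x => enc (a x)) by exists a'.
have [h rh hh] := computable_succ (computable_pairn ca' cs).
by exists h.
Qed.

(* A list is read off its code by peeling one [pairn] per cell, and the code
   bounds the number of cells. *)
Lemma computable_foldl (f : X -> T -> S -> T) (z : X -> T) (s : X -> seq S) :
  computable z -> computable s ->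
  computable (fun y : X * (T * S) => f y.1 y.2.1 y.2.2) ->
  computable (fun x => foldl (f x) (z x) (s x)).
Proof.
move=> [z' rz hz] [s' rs hs] [f' rf hf].
pose step (u p : nat) := if sndn p is k.+1
  then pairn (f' (pairn u (pairn (fstn p) (fstn k)))) (sndn k) else p.
pose F u := fstn (iter (s' u) (step u) (pairn (z' u) (s' u))).
have [F' rF hF] : computable F.
  have cz : computable z' by exists z'.
  have cs : computable s' by exists s'.
  have cf : computable f' by exists f'.
  apply: computable_fstn; apply: computable_iter => //; comp => //.
  by apply: computable_nat_case; comp.
exists F' => // x; change (enc x) with (@enc nat _ (enc x)); rewrite hF /F hz hs /=.
have {hf F hF F' rF}stepE y a t :
    step (enc x) (pairn (enc y) (code_seq (map enc (a :: t)))) =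
    pairn (enc (f x y a)) (code_seq (map enc t)).
  rewrite /step sndnK /= !fstnK !sndnK; congr pairn.
  exact: (hf (x, (y, a))).
have key (t : seq S) y N : size t <= N ->
    fstn (iter N (step (enc x)) (pairn (enc y) (code_seq (map enc t)))) =
    enc (foldl (f x) y t).
  elim: t y N => [|a t IH] y N.
    move=> _; elim: N => [|N IHN]; first by rewrite /= fstnK.
    by rewrite iterSr [step _ _]/step sndnK.
  by case: N => // N hN; rewrite iterSr stepE IH.
apply: key; elim: (s x) => //= a t IH; rewrite ltnS; apply: leq_trans IH _.
exact: leq_trans (leq_addl _ _) (leq_pairn _ _).
Qed.

End Seq.
Ltac computable_seq :=
  lazymatch goal with
  | |- computable (fun x => _ :: _) => apply: computable_cons
  | |- computable (fun x => foldl _ _ _) => apply: computable_foldl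
  | _ => computable_nat
  end.
Ltac computable_step ::= computable_seq.

Section SeqFunctions.
Context X `{encodable X} S `{encodable S} T `{encodable T}.

Lemma computable_rev (s : X -> seq S) :
  computable s -> computable (fun x => rev (s x)).
Proof.
move=> cs; apply: (computable_ext
    (f := fun x => foldl (fun r a => a :: r) [::] (s x))).
  by move=> x; rewrite -[s x in LHS]revK foldl_rev -[RHS]cats0; elim: (rev _) => //= a r ->.
by apply: (computable_foldl (f := fun _ r a => a :: r)); comp.
Qed.

Lemma computable_foldr (f : X -> S -> T -> T) (z : X -> T) (s : X -> seq S) :
  computable z -> computable s ->
  computable (fun y : X * (S * T) => f y.1 y.2.1 y.2.2) ->
  computable (fun x => foldr (f x) (z x) (s x)).
Proof.
move=> cz cs cf.
apply: (computable_ext (f := fun x => foldl (fun r a => f x a r) (z x) (rev (s x)))).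
  by move=> x; rewrite foldl_rev.
apply: (computable_foldl (f := fun x r a => f x a r)); comp; first exact: computable_rev.
by apply: (computable_comp cf (g := fun y : X * (T * S) => (y.1, (y.2.2, y.2.1)))); comp.
Qed.

(** On codes: a nonempty list is the successor of a pair whose second half codes the tail, and 0
    codes the empty list, so a case distinction on the number is enough. *)
Lemma computable_behead (s : X -> seq S) :
  computable s -> computable (fun x => behead (s x)).
Proof.
move=> [s' rs hs]; have cs : computable s' by exists s'.
have [g rg hg] := computable_nat_case (g := fun _ k => sndn k) cs
  (computable_const 0) (computable_sndn computable_proj2).
by exists g => // x; rewrite (hg (enc x)) hs; case: (s x) => //= a t; rewrite sndnK.
Qed.

Lemma computable_head (z : X -> S) (s : X -> seq S) :
  computable z -> computable s -> computable (fun x => head (z x) (s x)).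
Proof.
move=> [z' rz hz] [s' rs hs]; have cs : computable s' by exists s'.
have cz : computable z' by exists z'.
have [g rg hg] := computable_nat_case (g := fun _ k => fstn k) cs cz
  (computable_fstn computable_proj2).
by exists g => // x; rewrite (hg (enc x)) hs; case: (s x) => //= a t; rewrite fstnK.
Qed.

End SeqFunctions.

Section SeqFunctions2.
Context X `{encodable X} S `{encodable S} T `{encodable T}.

Lemma computable_nth (z : X -> S) (s : X -> seq S) (i : X -> nat) :
  computable z -> computable s -> computable i ->
  computable (fun x => nth (z x) (s x) (i x)).
Proof.
move=> cz cs ci.
apply: (computable_ext (f := fun x => head (z x) (iter (i x) behead (s x)))).
  move=> x; rewrite -nth0.
  by elim: (i x) (s x) => // n IH t; rewrite iterSr IH; case: t => //=; rewrite nth_nil.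
apply: computable_head => //.
by apply: (computable_iter (g := fun=> behead)) => //; apply: computable_behead; comp.
Qed.

Lemma computable_map (f : X -> S -> T) (s : X -> seq S) :
  computable s -> computable (fun y : X * S => f y.1 y.2) ->
  computable (fun x => map (f x) (s x)).
Proof.
move=> cs cf.
apply: (computable_foldr (f := fun x a r => f x a :: r)); comp.
Qed.

Lemma computable_filter (f : X -> S -> bool) (s : X -> seq S) :
  computable s -> computable (fun y : X * S => f y.1 y.2) ->
  computable (fun x => filter (f x) (s x)).
Proof.
move=> cs cf.
apply: (computable_foldr (f := fun x a r => if f x a then a :: r else r)); comp.
Qed.

Lemma computable_all (f : X -> S -> bool) (s : X -> seq S) :
  computable s -> computable (fun y : X * S => f y.1 y.2) ->
  computable (fun x => all (f x) (s x)).
Proof.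
move=> cs cf.
apply: (computable_foldr (f := fun x a r => f x a && r)); comp.
Qed.

Lemma computable_has (f : X -> S -> bool) (s : X -> seq S) :
  computable s -> computable (fun y : X * S => f y.1 y.2) ->
  computable (fun x => has (f x) (s x)).
Proof.
move=> cs cf.
apply: (computable_foldr (f := fun x a r => f x a || r)); comp.
Qed.

Lemma computable_count (f : X -> S -> bool) (s : X -> seq S) :
  computable s -> computable (fun y : X * S => f y.1 y.2) ->
  computable (fun x => count (f x) (s x)).
Proof.
move=> cs cf.
apply: (computable_ext (f := fun x =>
  foldr (fun a r => if f x a then r.+1 else r) 0 (s x))).
  by move=> x; elim: (s x) => //= a t ->; case: (f x a).
apply: (computable_foldr (f := fun x a r => if f x a then r.+1 else r)); comp.
Qed.

Lemma computable_size (s : X -> seq S) :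
  computable s -> computable (fun x => size (s x)).
Proof.
move=> cs; apply: (computable_foldr (f := fun _ _ r => r.+1)); comp.
Qed.

Lemma computable_cat (s t : X -> seq S) :
  computable s -> computable t -> computable (fun x => s x ++ t x).
Proof.
move=> cs ct; apply: (computable_ext (f := fun x => foldr cons (t x) (s x))).
  by move=> x; elim: (s x) => //= a r ->.
by apply: (computable_foldr (f := fun _ a r => a :: r)); comp.
Qed.

End SeqFunctions2.

Ltac computable_seq2 :=
  lazymatch goal with
  | |- computable (fun x => map _ _) => apply: computable_map
  | |- computable (fun x => filter _ _) => apply: computable_filter
  | |- computable (fun x => all _ _) => apply: computable_all
  | |- computable (fun x => has _ _) => apply: computable_has
  | |- computable (fun x => count _ _) => apply: computable_count
  | |- computable (fun x => size _) => apply: computable_size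
  | |- computable (fun x => _ ++ _) => apply: computable_cat
  | |- computable (fun x => nth _ _ _) => apply: computable_nth
  | _ => computable_seq
  end.
Ltac computable_step ::= computable_seq2.

Section SeqFunctions3.
Context X `{encodable X} (S : eqType) `{encodable S}.

Lemma computable_flatten (s : X -> seq (seq S)) :
  computable s -> computable (fun x => flatten (s x)).
Proof.
by move=> cs; apply: (computable_foldr (f := fun _ a r => a ++ r)); comp.
Qed.

Lemma computable_mem (a : X -> S) (s : X -> seq S) :
  computable a -> computable s -> computable (fun x => a x \in s x).
Proof.
move=> ca cs; apply: (computable_ext (f := fun x => has (fun b => b == a x) (s x))).
  by move=> x; rewrite has_pred1.
by comp.
Qed.

Lemma computable_iota (a n : X -> nat) :
  computable a -> computable n -> computable (fun x => iota (a x) (n x)).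
Proof.
move=> ca cn; apply: (computable_ext
  (f := fun x => nat_rect _ [::] (fun k r => r ++ [:: a x + k]) (n x))).
  move=> x; elim: (n x) => //= k ->.
  by rewrite -[LHS]/(iota (a x) k ++ iota (a x + k) 1) -iotaD addn1.
apply: (computable_nat_rect (g := fun x k r => r ++ [:: a x + k])); by comp.
Qed.

Lemma computable_perm_eq (s t : X -> seq S) :
  computable s -> computable t -> computable (fun x => perm_eq (s x) (t x)).
Proof.
move=> cs ct; apply: (computable_ext (f := fun x =>
  all (fun a => count (fun b => b == a) (s x) == count (fun b => b == a) (t x))
      (s x ++ t x))); first by [].
by comp.
Qed.

End SeqFunctions3.

(** * Elimination of compound cuts *)

Lemma perm_eq_mem_cons (T : eqType) (a : T) s :
  a \in s -> exists t, perm_eq s (a :: t).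
Proof. by move=> /perm_to_rem; exists (rem a s). Qed.

(** A permutation is an equality of counts for every predicate; for a fixed predicate the counts add
    up along concatenation, which leaves linear arithmetic. *)
Ltac perm_lia :=
  let a := fresh "a" in
  apply/permP => a;
  repeat match goal with H : is_true (perm_eq _ _) |- _ =>
    move/permP/(_ a): H => H end;
  repeat rewrite -> count_cat in *; simpl in *;
  repeat rewrite -> count_cat in *; lia.

Section CutElimination.
Variable W : countType.
Implicit Types (p q r : formula W) (G D u : seq (formula W)).

(* The permutations of the six letters in the axioms (ii). *)
Definition relabellings : seq (seq nat) := [:: [:: 1; 2; 0; 4; 5; 3]; [:: 0; 5; 4; 3; 2; 1]].

(** For the lists in [relabellings] all indices are below 6, so the default [x0] is never returned;
    quantifying over it avoids choosing a letter. *)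
Definition relabelled (k : seq nat) (t t' : sextuple W) : Prop :=
  forall x0, tval (val t') = [seq nth x0 (tval (val t)) i | i <- k].

Definition surface_axiom u : Prop :=
  exists (L : delta_complex) (lab : cell L 0 + cell L 1 -> W)
    (ML : M_complex L) (inj : injective lab) (L2 : seq (cell L 2)),
    [/\ uniq L2, forall x, x \in L2 & u = [seq Atom (nu ML inj x) | x <- L2]].

(** Cuts are on atoms only. The permutation premise inside the rules makes lists behave as multisets
    without an exchange rule, so an induction on derivations meets logical rules only. Surface
    axioms need none, as the enumeration of the triangles is arbitrary. *)
Inductive nd : seq (formula W) -> Prop :=
| nd_surface u : surface_axiom u -> nd u
| nd_relabel k t t' u : k \in relabellings -> relabelled k t t' ->
    perm_eq u [:: Atom t; Atom t'] -> nd u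
| nd_cut G D t u : nd (Atom t :: G) -> nd (Atom t :: D) ->
    perm_eq u (G ++ D) -> nd u
| nd_mix G D u : nd G -> nd D -> perm_eq u (G ++ D) -> nd u
| nd_dia G p q u : nd (p :: G) -> nd (q :: G) ->
    perm_eq u (Dia p q :: G) -> nd u
| nd_iff G D p q u : nd (p :: G) -> nd (q :: D) ->
    perm_eq u (Iff p q :: G ++ D) -> nd u.

(** Permuting the axiom amounts to enumerating the triangles in another order. The permutation is
    turned into a list of positions, which can be applied to the cells themselves. *)
Lemma surface_axiom_perm u u' : perm_eq u u' -> surface_axiom u -> surface_axiom u'.
Proof.
move=> pu [L [lab [ML [inj [L2 [un full eu]]]]]]; exists L, lab, ML, inj.
case: L2 => [|y0 L2] in un full eu *.
  exists [::]; split=> //; apply/eqP.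
  by rewrite -size_eq0 -(perm_size pu) eu.
move: pu; rewrite {u}eu perm_sym => /(perm_iotaP (Atom (nu ML inj y0))).
rewrite size_map => -[Is pIs ->]; set s := y0 :: L2 in un full pIs *.
have ps : perm_eq [seq nth y0 s i | i <- Is] s.
  by rewrite -[X in perm_eq _ X](mkseq_nth y0) /mkseq perm_map.
exists [seq nth y0 s i | i <- Is]; split.
- by rewrite (perm_uniq ps).
- by move=> x; rewrite (perm_mem ps).
- rewrite -map_comp; apply/eq_in_map => i.
  by rewrite (perm_mem pIs) mem_iota => /andP[_ hi]; apply: (nth_map y0).
Qed.

Lemma nd_perm u u' : perm_eq u u' -> nd u -> nd u'.
Proof.
move=> pu nu; case: nu pu => {u}.
- by move=> u su pu; apply/nd_surface/(surface_axiom_perm pu).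
- move=> k t t' u kr kt pt pu; apply: (nd_relabel kr kt); perm_lia.
- move=> G D t u nG nD pGD pu; apply: (nd_cut nG nD); perm_lia.
- move=> G D u nG nD pGD pu; apply: (nd_mix nG nD); perm_lia.
- move=> G p q u nG nD pGD pu; apply: (nd_dia nG nD); perm_lia.
- move=> G D p q u nG nD pGD pu; apply: (nd_iff nG nD); perm_lia.
Qed.

Definition is_atom p : bool := if p is Atom _ then true else false.

Lemma surface_axiom_atoms u : surface_axiom u -> all is_atom u.
Proof. by move=> [L [lab [ML [inj [L2 [_ _ ->]]]]]]; rewrite all_map; apply/allP. Qed.

Definition introduced p G : Prop :=
  match p with
  | Atom _ => False
  | Dia p q => nd (p :: G) /\ nd (q :: G)
  | Iff p q => exists G1 G2, [/\ perm_eq G (G1 ++ G2), nd (p :: G1) & nd (q :: G2)]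
  end.

(* A cut on a compound formula is pushed up one of its premises, to the point
   where that premise introduces the cut formula. *)
Lemma cut_upward r X : ~~ is_atom r ->
  (forall G, introduced r G -> nd (G ++ X)) ->
  forall u, nd u -> forall G, perm_eq u (r :: G) -> nd (G ++ X).
Proof.
move=> cr H u; elim=> {u}.
- move=> u /surface_axiom_atoms au G pu; case/negP: cr; apply: (allP au).
  by rewrite (perm_mem pu) mem_head.
- move=> k t t' u _ _ pt G pu; case/negP: cr.
  have : r \in [:: Atom t; Atom t'] by rewrite -(perm_mem pt) (perm_mem pu) mem_head.
  by rewrite !inE => /orP[] /eqP ->.
- move=> G1 D1 t u n1 IH1 n2 IH2 pu G pG.
  have : r \in G1 ++ D1 by rewrite -(perm_mem pu) (perm_mem pG) mem_head.
  rewrite mem_cat => /orP[] /perm_eq_mem_cons[K pK].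
    apply: (nd_cut (G := K ++ X) (t := t) _ n2); last by perm_lia.
    by rewrite -cat_cons; apply: IH1; perm_lia.
  apply: (nd_cut (D := K ++ X) n1 (t := t)); last by perm_lia.
  by rewrite -cat_cons; apply: IH2; perm_lia.
- move=> G1 D1 u n1 IH1 n2 IH2 pu G pG.
  have : r \in G1 ++ D1 by rewrite -(perm_mem pu) (perm_mem pG) mem_head.
  rewrite mem_cat => /orP[] /perm_eq_mem_cons[K pK].
    by apply: (nd_mix (G := K ++ X) _ n2); [apply: IH1 | perm_lia].
  by apply: (nd_mix (D := K ++ X) n1); [apply: IH2 | perm_lia].
- move=> G1 p q u n1 IH1 n2 IH2 pu G pG.
  have : r \in Dia p q :: G1 by rewrite -(perm_mem pu) (perm_mem pG) mem_head.
  rewrite inE; case: eqP => /= [e _ | _ /perm_eq_mem_cons[K pK]].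
    rewrite {}e in H pG.
    apply: (@nd_perm (G1 ++ X)); first by perm_lia.
    exact: H.
  apply: (nd_dia (G := K ++ X) (p := p) (q := q)); last by perm_lia.
    by rewrite -cat_cons; apply: IH1; perm_lia.
  by rewrite -cat_cons; apply: IH2; perm_lia.
- move=> G1 D1 p q u n1 IH1 n2 IH2 pu G pG.
  have : r \in Iff p q :: G1 ++ D1 by rewrite -(perm_mem pu) (perm_mem pG) mem_head.
  rewrite inE mem_cat; case: eqP => /= [e _ | _ /orP[] /perm_eq_mem_cons[K pK]].
  + rewrite {}e in H pG.
    apply: (@nd_perm (G1 ++ D1 ++ X)); first by perm_lia.
    by rewrite catA; apply: H; exists G1, D1.
  + apply: (nd_iff (G := K ++ X) (p := p) (q := q) _ n2); last by perm_lia.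
    by rewrite -cat_cons; apply: IH1; perm_lia.
  + apply: (nd_iff (D := K ++ X) (p := p) (q := q) n1); last by perm_lia.
    by rewrite -cat_cons; apply: IH2; perm_lia.
Qed.

(** Induction on the cut formula, following each premise in turn up to where it introduces that
    formula. Two introductions of [Dia p q] both have a premise with [p], so a single smaller cut is
    enough; two introductions of [Iff p q] give one cut on [p] and one on [q], whose conclusions are
    joined by [nd_mix]. *)
Lemma nd_cut_general r G D : nd (r :: G) -> nd (r :: D) -> nd (G ++ D).
Proof.
elim: r G D => [t | p IHp q IHq | p IHp q IHq] G D nG nD.
- exact: nd_cut nG nD (perm_refl _).
- apply: (cut_upward (r := Dia p q) _ _ nG) => // {nG}G [nG _].
  apply: (@nd_perm (D ++ G)); first by perm_lia.
  apply: (cut_upward (r := Dia p q) _ _ nD) => // {nD}D [nD _].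
  exact: IHp.
- apply: (cut_upward (r := Iff p q) _ _ nG) => // {nG}G [G1 [G2 [pG nG1 nG2]]].
  apply: (@nd_perm (D ++ G)); first by perm_lia.
  apply: (cut_upward (r := Iff p q) _ _ nD) => // {nD}D [D1 [D2 [pD nD1 nD2]]].
  apply: (nd_mix (IHp _ _ nG1 nD1) (IHq _ _ nG2 nD2)); perm_lia.
Qed.

Local Open Scope mset_scope.

Lemma seq_mset_cons p u : seq_mset (p :: u) = p +` seq_mset u.
Proof.
by apply/msetP => a; rewrite !msetE2 !mset_seqE /= msetnE eq_sym; case: eqP.
Qed.

Lemma seq_mset_cat u u' : seq_mset (u ++ u') = seq_mset u `+` seq_mset u'.
Proof. by apply/msetP => a; rewrite msetE2 !mset_seqE count_cat. Qed.

Lemma seq_mset2 p q : seq_mset [:: p; q] = [mset p] `+` [mset q].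
Proof.
by rewrite !seq_mset_cons; congr (_ `+` _); apply/msetP => a; rewrite !msetE2 mset_seqE addn0.
Qed.

Lemma nd_derivable u : nd u -> derivable (seq_mset u).
Proof.
have eqm u1 u2 : perm_eq u1 u2 -> seq_mset u1 = seq_mset u2 by move/eq_seq_msetP.
elim=> {u}.
- by move=> u [L [lab [ML [inj [L2 [un full ->]]]]]]; apply: ax_complex.
- move=> k [st ht] [st' ht'] u kr.
  case/tupleP: st ht => A st; case/tupleP: st => B st; case/tupleP: st => C st.
  case/tupleP: st => P st; case/tupleP: st => Q st; case/tupleP: st => R st.
  case/tupleP: st' ht' => A' st'; case/tupleP: st' => B' st'; case/tupleP: st' => C' st'.
  case/tupleP: st' => P' st'; case/tupleP: st' => Q' st'; case/tupleP: st' => R' st'.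
  rewrite (tuple0 st) (tuple0 st') => ht' ht /(_ A) /= kt.
  (* A sextuple is determined by its letters, because its second component proves a boolean
     equation. *)
  have eS (w : 6.-tuple W) (hw : uniq w) a b c d e f (h : uniq [:: a; b; c; d; e; f]) :
      tval w = [:: a; b; c; d; e; f] -> exist _ w hw = Sextuple h :> sextuple W.
    by move=> e'; do 2 apply: val_inj.
  move: kr; rewrite !inE => /orP[] /eqP ek; move: kt; rewrite {}ek /= => -[? ? ? ? ? ?];
    subst; move=> /eqm ->; rewrite seq_mset2.
  - by rewrite (eS _ ht _ _ _ _ _ _ ht) // (eS _ ht' _ _ _ _ _ _ ht'); first exact: ax_cycle.
  - by rewrite (eS _ ht _ _ _ _ _ _ ht) // (eS _ ht' _ _ _ _ _ _ ht'); first exact: ax_swap.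
- move=> G D t u _; rewrite !seq_mset_cons => IHG _ IHD /eqm ->.
  by rewrite seq_mset_cat; apply: cut IHG IHD.
- by move=> G D u _ IHG _ IHD /eqm ->; rewrite seq_mset_cat; apply: cut_empty.
- move=> G p q u _; rewrite !seq_mset_cons => IHp _ IHq /eqm ->.
  by rewrite seq_mset_cons; apply: dia_intro.
- move=> G D p q u _; rewrite !seq_mset_cons => IHp _ IHq /eqm ->.
  by rewrite seq_mset_cons seq_mset_cat; apply: iff_intro.
Qed.

Lemma derivable_nd u : derivable (seq_mset u) -> nd u.
Proof.
(* The multiset is replaced by a variable with an equation, so that the induction on [derivable]
   leaves the listing [u] free in every case. *)
move: {-2}(seq_mset u) (erefl (seq_mset u)) => M eM dM.
have eqm (v1 v2 : seq (formula W)) : seq_mset v1 = seq_mset v2 -> perm_eq v2 v1.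
  by move/eq_seq_msetP; rewrite perm_sym.
elim: dM u eM => {M}.
- move=> L lab ML inj L2 un full u /eqm pu.
  by rewrite perm_sym in pu; apply: nd_surface; apply: surface_axiom_perm pu _; exists L, lab, ML, inj, L2.
- move=> A B C P Q R h h' u; rewrite -seq_mset2 => /eqm.
  by apply: (nd_relabel (k := [:: 1; 2; 0; 4; 5; 3]) (t := Sextuple h) (t' := Sextuple h')).
- move=> A B C P Q R h h' u; rewrite -seq_mset2 => /eqm.
  by apply: (nd_relabel (k := [:: 0; 5; 4; 3; 2; 1]) (t := Sextuple h) (t' := Sextuple h')).
- move=> G D p _ IHG _ IHD u; rewrite -[G]seq_mset_id -[D]seq_mset_id -seq_mset_cat => /eqm.
  rewrite perm_sym => pu; apply: (nd_perm pu); apply: (nd_cut_general (r := p)).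
    by apply: IHG; rewrite seq_mset_cons seq_mset_id.
  by apply: IHD; rewrite seq_mset_cons seq_mset_id.
- move=> G D _ IHG _ IHD u; rewrite -[G]seq_mset_id -[D]seq_mset_id -seq_mset_cat => /eqm.
  by apply: nd_mix; [apply: IHG | apply: IHD]; rewrite seq_mset_id.
- move=> G p q _ IHp _ IHq u; rewrite -[G]seq_mset_id -seq_mset_cons => /eqm.
  by apply: nd_dia; [apply: IHp | apply: IHq]; rewrite seq_mset_cons seq_mset_id.
- move=> G D p q _ IHp _ IHq u; rewrite -[G]seq_mset_id -[D]seq_mset_id.
  rewrite -seq_mset_cat -seq_mset_cons => /eqm.
  by apply: nd_iff; [apply: IHp | apply: IHq]; rewrite seq_mset_cons seq_mset_id.
Qed.

End CutElimination.

(** * Triangulated surfaces *)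

Section Triangles.
Variable L : delta_complex.
Implicit Types (x u : cell L 2) (a : cell L 1) (w : cell L 0).
Local Open Scope delta_scope.

(* Vertex [k] of a triangle is opposite to its edge [k], and edge [k] runs from
   vertex [edge_lo k] to vertex [edge_hi k]. *)
Definition edge_lo k := if k == 0 then 1 else 0.
Definition edge_hi k := if k == 2 then 1 else 2.

Definition tri_edge x k : cell L 1 := 'd_k x.
Definition tri_vertex x k : cell L 0 :=
  nth ('d_0 ('d_0 x)) [:: 'd_1 ('d_2 x); 'd_0 ('d_2 x)] k.

Lemma face_face x j l : j <= l -> l < 2 -> 'd_j ('d_l.+1 x) = 'd_l ('d_j x) :> cell L 0.
Proof.
move=> jl l2; have j2 := leq_ltn_trans jl l2.
have := @faceP L 0 (inord j) (inord l) x; rewrite !inordK // => /(_ jl).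
have -> : fintype.lift ord0 (inord l : 'I_2) = inord l.+1.
  by apply: val_inj; rewrite /= /bump /= !inordK.
have -> // : widen_ord (leqnSn _) (inord j : 'I_2) = inord j.
by apply: val_inj; rewrite /= !inordK // ltnW.
Qed.

Lemma edge_lo_face x k : k < 3 -> 'd_1 (tri_edge x k) = tri_vertex x (edge_lo k).
Proof.
case: k => [|[|[|//]]] _ //=; rewrite /tri_vertex /tri_edge /=.
  by rewrite (@face_face x 0).
by rewrite -(@face_face x 1).
Qed.

Lemma edge_hi_face x k : k < 3 -> 'd_0 (tri_edge x k) = tri_vertex x (edge_hi k).
Proof.
case: k => [|[|[|//]]] _ //=; rewrite /tri_vertex /tri_edge /=.
by rewrite (@face_face x 0).
Qed.

Lemma is_face2P a x : is_face a x <-> exists2 k, k < 3 & tri_edge x k = a.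
Proof.
split=> [[i <-]|[k k3 <-]]; last by exists (inord k).
by exists i => //; rewrite /tri_edge inord_val.
Qed.

Lemma is_face1P w a : is_face w a <-> 'd_1 a = w \/ 'd_0 a = w.
Proof.
split=> [[i <-]|[] <-]; [|by exists (inord 1)|by exists (inord 0)].
by case: i => [[|[|//]] i2]; [right|left]; congr face; apply: val_inj; rewrite /= inordK.
Qed.

Lemma is_vertex2P w x : is_vertex2 w x <-> exists2 k, k < 3 & tri_vertex x k = w.
Proof.
split=> [[a /is_face2P[k k3 <-] /is_face1P[]]|[k k3 <-]].
- by rewrite edge_lo_face // => <-; exists (edge_lo k) => //; rewrite /edge_lo; case: eqP.
- by rewrite edge_hi_face // => <-; exists (edge_hi k) => //; rewrite /edge_hi; case: eqP.
- have f2 a i : 'd_i x = a -> i < 3 -> is_face a x by move=> <- _; exists (inord i).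
  case: k k3 => [|[|[|//]]] _.
  + by exists ('d_2 x); [exact: f2 (erefl _) _ | apply/is_face1P; left].
  + by exists ('d_2 x); [exact: f2 (erefl _) _ | apply/is_face1P; right].
  + by exists ('d_0 x); [exact: f2 (erefl _) _ | apply/is_face1P; right].
Qed.

End Triangles.

(** * Coefficients of a boundary at an edge *)

Section Boundary.
Variable L : delta_complex.
Import GRing.Theory.
Local Open Scope ring_scope.

Lemma boundary_is_additive n : zmod_morphism (@boundary L n).
Proof. exact: lift_is_additive. Qed.

HB.instance Definition _ n :=
  GRing.isZmodMorphism.Build (chain L n.+1) (chain L n) (@boundary L n)
    (@boundary_is_additive n).

Hypothesis face_inj : forall x : cell L 2, injective (fun i => face L i x).

(** The sum is the coefficient of [a] in the boundary of [x]; as the three faces of [x] are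
    distinct, one term survives. *)
Lemma incidence (x : cell L 2) k a : (k < 3)%N ->
  tri_edge x k = a ->
  \sum_(i < 3) (-1) ^+ i * (face L i x == a)%:R = (-1) ^+ k :> int.
Proof.
move=> k3 <-; rewrite (bigD1 (inord k)) //= eqxx mulr1 inordK // big1 ?addr0 //.
move=> i ik; case: eqP => [/face_inj e|]; last by rewrite mulr0.
by rewrite e eqxx in ik.
Qed.

Lemma incidence0 (x : cell L 2) a : ~ is_face a x ->
  \sum_(i < 3) (-1) ^+ i * (face L i x == a)%:R = 0 :> int.
Proof.
move=> nf; rewrite big1 // => i _; case: eqP => [e|]; last by rewrite mulr0.
by case: nf; exists i.
Qed.

(* The coefficient of an edge in a boundary only involves its two sides. *)
Lemma coeff_boundary (D : chain L 2) (x1 x2 : cell L 2) k1 k2 :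
  (k1 < 3)%N -> (k2 < 3)%N -> x1 <> x2 -> tri_edge x1 k1 = tri_edge x2 k2 ->
  (forall x, is_face (tri_edge x1 k1) x -> x = x1 \/ x = x2) ->
  coeff (tri_edge x1 k1) (boundary D) =
    (-1) ^+ k1 * coeff x1 D + (-1) ^+ k2 * coeff x2 D.
Proof.
move=> k13 k23 nx ee sides.
rewrite -[D]freeg_sumE [boundary _]raddf_sum !raddf_sum /= !mulr_sumr -big_split /=.
apply: eq_bigr => z _; rewrite [boundary _]liftU coeffZ !coeffU raddf_sum /=.
under eq_bigr do rewrite coeffZ coeffU mul1r.
rewrite mulrCA (mulrCA (_ ^+ k2)) -mulrDr; congr (_ * _).
have [->|/eqP n1] := eqVneq z x1.
  by rewrite (incidence k13) // (negPf (introN eqP nx)) mulr1 mulr0 addr0.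
have [->|/eqP n2] := eqVneq z x2.
  by rewrite (incidence k23) // mulr1 mulr0 add0r.
by rewrite incidence0 ?mulr0 ?addr0 // => /sides [].
Qed.

End Boundary.

(** * Closed surfaces as incidence tables *)

Section SurfaceTable.
Local Open Scope nat_scope.

(* A closed surface glued from the triangles [0, ..., n - 1]; [v i k] and
   [e i k] name vertex and edge [k] of triangle [i]. Connectedness is expressed
   through two-colourings of the set of triangles, and [st_orient] asks for an
   orientation of the triangles in which the two sides of an edge cancel. *)
Record surface_table (T : Type) (n : nat) (v e : nat -> nat -> T) : Prop := SurfaceTable {
  st_pos : 0 < n;
  st_disjoint : forall i k j m, i < n -> k < 3 -> j < n -> m < 3 -> v i k <> e j m;
  st_ends : forall i k j m, i < n -> k < 3 -> j < n -> m < 3 -> e i k = e j m ->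
    v i (edge_lo k) = v j (edge_lo m) /\ v i (edge_hi k) = v j (edge_hi m);
  st_sides : forall i k, i < n -> k < 3 -> exists j, [/\ j < n, j <> i,
    exists2 m, m < 3 & e j m = e i k &
    forall j' m, j' < n -> m < 3 -> e j' m = e i k -> j' = i \/ j' = j];
  st_link : forall i0 k0 (c : nat -> bool), i0 < n -> k0 < 3 ->
    (forall i k j m, i < n -> k < 3 -> j < n -> m < 3 -> e i k = e j m ->
      v i (edge_lo k) = v i0 k0 \/ v i (edge_hi k) = v i0 k0 -> c i = c j) ->
    forall j m, j < n -> m < 3 -> v j m = v i0 k0 -> c j = c i0;
  st_connected : forall c : nat -> bool,
    (forall i k j m, i < n -> k < 3 -> j < n -> m < 3 -> e i k = e j m -> c i = c j) ->
    forall i j, i < n -> j < n -> c i = c j;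
  st_orient : exists s : nat -> bool, forall i k j m, i < n -> k < 3 -> j < n -> m < 3 ->
    i <> j -> e i k = e j m -> s i (+) (k == 1) <> s j (+) (m == 1)
}.

Lemma edge_lo_lt k : edge_lo k < 3. Proof. by rewrite /edge_lo; case: eqP. Qed.
Lemma edge_hi_lt k : edge_hi k < 3. Proof. by rewrite /edge_hi; case: eqP. Qed.
Hint Resolve edge_lo_lt edge_hi_lt : core.

(** The record sees a table only through equalities between entries, so it is carried along any
    renaming that preserves and reflects them. This is used to pass between cells, letters and the
    numbers of letters. *)
Lemma surface_table_mono (T T' : Type) n (v e : nat -> nat -> T) (v' e' : nat -> nat -> T') :
  (forall i k j m, i < n -> k < 3 -> j < n -> m < 3 ->
    [/\ v i k = v j m <-> v' i k = v' j m, e i k = e j m <-> e' i k = e' j m &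
        v i k = e j m <-> v' i k = e' j m]) ->
  surface_table n v e -> surface_table n v' e'.
Proof.
move=> H [S1 S2 S3 S4 S5 S6 S7]; split => //.
- by move=> i k j m i_n k3 j_n m3; have [_ _ <-] := H i k j m i_n k3 j_n m3; apply: S2.
- move=> i k j m i_n k3 j_n m3; have [_ <- _] := H i k j m i_n k3 j_n m3.
  move=> /(S3 _ _ _ _ i_n k3 j_n m3)[].
  have [-> _ _] := H i (edge_lo k) j (edge_lo m) i_n (edge_lo_lt k) j_n (edge_lo_lt m).
  by have [-> _ _] := H i (edge_hi k) j (edge_hi m) i_n (edge_hi_lt k) j_n (edge_hi_lt m).
- move=> i k i_n k3; have [j [j_n nj [m m3 em] js]] := S4 i k i_n k3.
  exists j; split => //; first by exists m => //; have [_ <- _] := H j m i k j_n m3 i_n k3.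
  move=> j' m' j'_n m'3; have [_ <- _] := H j' m' i k j'_n m'3 i_n k3; exact: js.
- move=> i0 k0 c i0_n k03 Hc j m j_n m3.
  have [<- _ _] := H j m i0 k0 j_n m3 i0_n k03.
  apply: (S5 i0 k0 c) => // i k j' m' i_n k3 j'_n m'3.
  have [_ -> _] := H i k j' m' i_n k3 j'_n m'3.
  have [-> _ _] := H i (edge_lo k) i0 k0 i_n (edge_lo_lt k) i0_n k03.
  have [-> _ _] := H i (edge_hi k) i0 k0 i_n (edge_hi_lt k) i0_n k03.
  exact: Hc.
- move=> c Hc; apply: S6 => i k j m i_n k3 j_n m3.
  have [_ -> _] := H i k j m i_n k3 j_n m3; exact: Hc.
- have [s Hs] := S7; exists s => i k j m i_n k3 j_n m3 nij.
  have [_ <- _] := H i k j m i_n k3 j_n m3; exact: Hs.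
Qed.

End SurfaceTable.

(** * The incidence table of a complex *)

Section TableOfComplex.
Import GRing.Theory Num.Theory.
Variable L : delta_complex.
Hypothesis ML : M_complex L.
Variable L2 : seq (cell L 2).
Hypotheses (uniqL2 : uniq L2) (fullL2 : forall x, x \in L2).

(** The image of 1 under the injection of the integers is a nonzero chain, so some triangle lies in
    its support. *)
Lemma M_complex_cell2 : exists x0 : cell L 2, True.
Proof.
have [g ginj _] := M_H2 ML.
case E : (dom (g 1%R)) => [|x0 s]; last by exists x0.
move/eqP: E; rewrite dom_eq0 => /eqP E.
by have := ginj 1%R 0%R; rewrite E raddf0 => /(_ erefl).
Qed.

Lemma vertex_colour (c : cell L 2 -> bool) w :
  (forall u u', neighbours w u u' -> c u = c u') ->
  forall u u', is_vertex2 w u -> is_vertex2 w u' -> c u = c u'.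
Proof.
by move=> Hc u u' wu wu'; elim: (M_link ML wu wu') => [x y|x|x y z _ -> _ ->] //; apply: Hc.
Qed.

(** Connectedness is given for 0-cells and has to be spread to triangles. The link condition makes
    the colour constant around a vertex, and a triangle containing a given 1-cell has both of its
    ends as vertices, so the colour does not change along a path of 1-cells. *)
Lemma constant_colour (c : cell L 2 -> bool) :
  (forall a u u', is_face a u -> is_face a u' -> c u = c u') ->
  forall u u', c u = c u'.
Proof.
move=> Hc.
have vc (w : cell L 0) u u' : is_vertex2 w u -> is_vertex2 w u' -> c u = c u'.
  by apply: vertex_colour => x y [a [_ ax ay]]; apply: Hc ax ay.
have cov (w : cell L 0) : exists u, is_vertex2 w u.
  have [a wa] := M_cell0 ML w; have [u au] := M_cell1 ML a.
  by exists u, a.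
have path (w w' : cell L 0) : clos_refl_trans _ (@adjacent0 L) w w' ->
    forall u u', is_vertex2 w u -> is_vertex2 w' u' -> c u = c u'.
  elim=> [y z [a yz]|y|y z t _ IH1 _ IH2] u u' hu hu'.
  - have [x ax] := M_cell1 ML a.
    have ya : is_face y a by apply/is_face1P; case: yz => -[]; [right|left].
    have za : is_face z a by apply/is_face1P; case: yz => -[]; [left|right].
    by rewrite (vc y u x) //; [apply: vc hu' | ]; exists a.
  - exact: vc hu hu'.
  - by have [x zx] := cov z; rewrite (IH1 _ _ hu zx) (IH2 _ _ zx hu').
move=> u u'; set w := tri_vertex u 0; set w' := tri_vertex u' 0.
have wu : is_vertex2 w u by apply/is_vertex2P; exists 0.
have wu' : is_vertex2 w' u' by apply/is_vertex2P; exists 0.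
have [e|/eqP nw] := eqVneq w w'; first by apply: (vc w) => //; rewrite e.
exact: path (M_connected ML nw) _ _ wu wu'.
Qed.

Lemma complex_table x0 : surface_table (size L2)
  (fun i k => inl (tri_vertex (nth x0 L2 i) k) : cell L 0 + cell L 1)
  (fun i k => inr (tri_edge (nth x0 L2 i) k)).
Proof.
have ltL2 (x : cell L 2) : index x L2 < size L2 by rewrite index_mem.
have nthL2 (x : cell L 2) : nth x0 L2 (index x L2) = x by rewrite nth_index.
have inl_eq (a b : cell L 0) : inl a = inl b :> cell L 0 + cell L 1 -> a = b by case.
have inr_eq (a b : cell L 1) : inr a = inr b :> cell L 0 + cell L 1 -> a = b by case.
have edge_face (x : cell L 2) k : k < 3 -> is_face (tri_edge x k) x.
  by move=> k3; apply/is_face2P; exists k.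
split.
- by apply: leq_ltn_trans (ltL2 x0).
- by [].
- move=> i k j m _ k3 _ m3 /inr_eq e.
  by split; congr inl; [rewrite -!edge_lo_face // e | rewrite -!edge_hi_face // e].
- move=> i k i_n k3; set x := nth x0 L2 i.
  have [u1 [u2 [nu sides]]] := M_two_sides ML (tri_edge x k).
  have [y [ny fy sy]] : exists y, [/\ y <> x, is_face (tri_edge x k) y &
      forall u, is_face (tri_edge x k) u -> u = x \/ u = y].
    have fx := edge_face x k k3.
    case/sides: (fx) => ex.
      exists u2; split; [by rewrite ex => /esym | by apply/sides; right |].
      by move=> u /sides; rewrite ex.
    exists u1; split; [by rewrite ex | by apply/sides; left |].
    by move=> u /sides [] ->; rewrite ex; [right|left].
  exists (index y L2); split => //.
  + by move=> e; apply: ny; rewrite /x -e nthL2.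
  + by case/is_face2P: fy => m m3 em; exists m => //; rewrite nthL2 em.
  + move=> j m j_n m3 /inr_eq em.
    have := edge_face (nth x0 L2 j) m m3; rewrite em => /sy [] e; [left|right].
      by apply/eqP; rewrite -(nth_uniq x0 j_n i_n uniqL2) e.
    by rewrite -e index_uniq.
- move=> i0 k0 c i0_n k03 Hc j m j_n m3 /inl_eq em.
  set w := tri_vertex (nth x0 L2 i0) k0.
  have := @vertex_colour (fun x => c (index x L2)) w _ (nth x0 L2 j) (nth x0 L2 i0).
  rewrite !index_uniq //; apply; last 2 first.
  + by apply/is_vertex2P; exists m.
  + by apply/is_vertex2P; exists k0.
  move=> u u' [a [wa /is_face2P[k k3 ek] /is_face2P[k' k3' ek']]].
  apply: (Hc _ k _ k') => //; rewrite !nthL2; first by rewrite ek ek'.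
  by case/is_face1P: wa; rewrite -ek ?edge_lo_face ?edge_hi_face // => ->; [left|right].
- move=> c Hc i j i_n j_n.
  have := @constant_colour (fun x => c (index x L2)) _ (nth x0 L2 i) (nth x0 L2 j).
  rewrite !index_uniq //; apply => a u u' /is_face2P[k k3 ek] /is_face2P[k' k3' ek'].
  by apply: (Hc _ k _ k') => //; rewrite !nthL2 ek ek'.
(* The orientation is read off the signs of the coefficients of a generator [D] of the cycles. The
   balance at an edge shows that the coefficients of its two sides vanish together; by connectedness
   a single zero would make [D] zero, against injectivity of [g]. *)
- have [g ginj Hg] := M_H2 ML; pose D := g 1%R.
  have bD : boundary D = 0%R by apply/Hg; exists 1%R.
  have bal (x y : cell L 2) k m : k < 3 -> m < 3 -> x <> y -> tri_edge x k = tri_edge y m ->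
      ((-1) ^+ k * coeff x D + (-1) ^+ m * coeff y D = 0)%R.
    move=> k3 m3 nxy exy; rewrite -coeff_boundary ?bD ?coeff0 //.
      exact: (M_face2_inj ML).
    have [u1 [u2 [_ sides]]] := M_two_sides ML (tri_edge x k).
    move=> z; have := edge_face x k k3; have := edge_face y m m3; rewrite -exy.
    move=> /sides ex /sides ey /sides ez.
    by case: ex ey ez nxy => -> [] -> [] ->; auto.
  (* Among the three edges only the middle one enters the boundary with a minus sign, whence the
     test [k == 1] in [st_orient]. *)
  have sgn3 k : k < 3 -> ((-1) ^+ k = (-1) ^+ (k == 1)%N :> int)%R by case: k => [|[|[|k]]].
  have nz (x : cell L 2) : (coeff x D != 0)%R.
    have cc (u u' : cell L 2) : (coeff u D == 0)%R = (coeff u' D == 0)%R.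
      apply: (@constant_colour (fun x => coeff x D == 0)%R) => a {}u {}u'.
      move=> /is_face2P[k k3 ek] /is_face2P[k' k3' ek'].
      have [->//|/eqP nuu] := eqVneq u u'.
      have := bal u u' k k' k3 k3' nuu; rewrite ek ek' => /(_ erefl) /eqP.
      rewrite addr_eq0 => /eqP /(congr1 (fun z => z == 0)%R).
      by rewrite oppr_eq0 !mulf_eq0 !signr_eq0.
    apply/eqP => /eqP Dx; suff : D = 0%R.
      by rewrite -(raddf0 g) => /ginj.
    apply/eqP/freeg_eqP => y; rewrite coeff0; apply/eqP; by rewrite (cc y x).
  exists (fun i => coeff (nth x0 L2 i) D > 0)%R => i k j m i_n k3 j_n m3 nij /inr_eq e.
  have nxy : nth x0 L2 i <> nth x0 L2 j.
    by move=> /eqP; rewrite nth_uniq // => /eqP.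
  move: (bal _ _ _ _ k3 m3 nxy e) (nz (nth x0 L2 i)) (nz (nth x0 L2 j)).
  rewrite !(sgn3 _ k3) !(sgn3 _ m3).
  by case: (k == 1); case: (m == 1); rewrite /= ?expr0 ?expr1 ?mul1r ?mulN1r; lia.
Qed.

End TableOfComplex.

(** * From tables to complexes *)

(** The conditions on tables quantify over boolean colourings, while the sets of triangles to which
    they will be applied are defined by reachability; classical logic bridges the two. *)
Lemma prop_colouring (P : nat -> Prop) : exists c : nat -> bool, forall i, c i <-> P i.
Proof.
exists (fun i => if excluded_middle_informative (P i) then true else false) => i.
by case: excluded_middle_informative.
Qed.

Section ComplexOfTable.
Import GRing.Theory Num.Theory.
Variables (W : choiceType) (n : nat) (v e : nat -> nat -> W).
Hypothesis tab : surface_table n v e.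
Hypothesis v_inj : forall i k m, i < n -> k < 3 -> m < 3 -> v i k = v i m -> k = m.
Hypothesis e_inj : forall i k m, i < n -> k < 3 -> m < 3 -> e i k = e i m -> k = m.

Definition table_flags := [seq (i, k) | i <- iota 0 n, k <- iota 0 3].
Definition table_vertices := [seq v ik.1 ik.2 | ik <- table_flags].
Definition table_edges := [seq e ik.1 ik.2 | ik <- table_flags].

Lemma mem_table_flags i k : ((i, k) \in table_flags) = (i < n) && (k < 3).
Proof.
apply/allpairsPdep/andP => [[i' [k' [+ + [-> ->]]]]|[i_n k3]].
  by rewrite !mem_iota.
by exists i, k; rewrite !mem_iota.
Qed.

Lemma mem_table_vertices i k : i < n -> k < 3 -> v i k \in table_vertices.
Proof. by move=> i_n k3; apply/mapP; exists (i, k); rewrite ?mem_table_flags ?i_n. Qed.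

Lemma mem_table_edges i k : i < n -> k < 3 -> e i k \in table_edges.
Proof. by move=> i_n k3; apply/mapP; exists (i, k); rewrite ?mem_table_flags ?i_n. Qed.

Definition vertex_cell := {w : W | w \in table_vertices}.
Definition edge_cell := {w : W | w \in table_edges}.

(** Made total so that bounds need not be carried: an entry not listed in the table falls back to
    [v 0 0], which is listed because [st_pos] provides a triangle. *)
Definition mk_vertex i k : vertex_cell :=
  insubd (Sub (v 0 0) (mem_table_vertices (st_pos tab) (isT : 0 < 3)) : vertex_cell) (v i k).
Definition mk_edge i k : edge_cell :=
  insubd (Sub (e 0 0) (mem_table_edges (st_pos tab) (isT : 0 < 3)) : edge_cell) (e i k).

Lemma mk_vertexE i k : i < n -> k < 3 -> val (mk_vertex i k) = v i k.
Proof. by move=> i_n k3; rewrite insubdK // mem_table_vertices. Qed.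

Lemma mk_edgeE i k : i < n -> k < 3 -> val (mk_edge i k) = e i k.
Proof. by move=> i_n k3; rewrite insubdK // mem_table_edges. Qed.

Lemma vertex_cellP (w : vertex_cell) : exists i k, [/\ i < n, k < 3 & w = mk_vertex i k].
Proof.
have /mapP[[i k]] := valP w; rewrite mem_table_flags => /andP[i_n k3] ew.
by exists i, k; split=> //; apply: val_inj; rewrite mk_vertexE.
Qed.

Lemma edge_cellP (a : edge_cell) : exists i k, [/\ i < n, k < 3 & a = mk_edge i k].
Proof.
have /mapP[[i k]] := valP a; rewrite mem_table_flags => /andP[i_n k3] ea.
by exists i, k; split=> //; apply: val_inj; rewrite mk_edgeE.
Qed.

(** A 1-cell is here a mere letter, so its ends must be read off a triangle on which it occurs. The
    first occurrence is taken; [st_ends] shows that any other would give the same ends. *)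
Definition edge_flag (a : edge_cell) : nat * nat :=
  nth (0, 0) table_flags (find (fun ik => mk_edge ik.1 ik.2 == a) table_flags).

Definition edge_end (j : 'I_2) (a : edge_cell) : vertex_cell :=
  mk_vertex (edge_flag a).1
    ((if j == 0 :> nat then edge_hi else edge_lo) (edge_flag a).2).

Lemma edge_endE j i k : i < n -> k < 3 ->
  edge_end j (mk_edge i k) = mk_vertex i ((if j == 0 :> nat then edge_hi else edge_lo) k).
Proof.
move=> i_n k3; rewrite /edge_end /edge_flag.
set P := fun ik => _; have hP : has P table_flags.
  by apply/hasP; exists (i, k); rewrite ?mem_table_flags ?i_n /P //= eqxx.
have := nth_find (0, 0) hP; have := mem_nth (0, 0) (eq_ind _ is_true hP _ (has_find _ _)).
case: (nth _ _ _) => i' k'; rewrite mem_table_flags /P /= => /andP[i'_n k'3].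
move=> /eqP /(congr1 val); rewrite !mk_edgeE //.
move=> /(st_ends tab i'_n k'3 i_n k3) [elo ehi]; apply: val_inj.
by case: ifP => _; rewrite !mk_vertexE // ?edge_lo_lt ?edge_hi_lt.
Qed.

Definition table_cell (m : nat) : choiceType :=
  match m with 0 => vertex_cell | 1 => edge_cell | 2 => 'I_n | _ => void end.

Definition table_face (m : nat) : 'I_m.+2 -> table_cell m.+1 -> table_cell m :=
  match m return 'I_m.+2 -> table_cell m.+1 -> table_cell m with
  | 0 => edge_end
  | 1 => fun i (x : 'I_n) => mk_edge x i
  | _ => fun _ x => match x : void with end
  end.

Lemma table_faceP m (j l : 'I_m.+2) (x : table_cell m.+2) : (j <= l)%N ->
  table_face j (table_face (fintype.lift ord0 l) x) =
  table_face l (table_face (widen_ord (leqnSn _) j) x).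
Proof.
case: m j l x => [|m] j l; last by case.
move=> x jl; rewrite /table_face !edge_endE ?ltn_ord //.
case: j jl => -[|[|//]] j2; case: l => -[|[|//]] l2 //=.
Qed.

Definition table_complex := DeltaComplex table_faceP.
Notation L := table_complex.

Lemma table_edge_face (x : 'I_n) k : k < 3 -> tri_edge (x : cell L 2) k = mk_edge x k.
Proof. by move=> k3; rewrite /tri_edge /= inordK. Qed.

Lemma table_vertex_face (x : 'I_n) k : k < 3 ->
  tri_vertex (x : cell L 2) k = mk_vertex x k.
Proof.
case: k => [|[|[|//]]] _; rewrite /tri_vertex /= inordK // edge_endE ?inordK //.
Qed.

Lemma mk_edge_eq i k j m : i < n -> k < 3 -> j < n -> m < 3 ->
  mk_edge i k = mk_edge j m <-> e i k = e j m.
Proof.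
move=> i_n k3 j_n m3; split=> [/(congr1 val)|ee]; first by rewrite !mk_edgeE.
by apply: val_inj; rewrite !mk_edgeE.
Qed.

Lemma mk_vertex_eq i k j m : i < n -> k < 3 -> j < n -> m < 3 ->
  mk_vertex i k = mk_vertex j m <-> v i k = v j m.
Proof.
move=> i_n k3 j_n m3; split=> [/(congr1 val)|ee]; first by rewrite !mk_vertexE.
by apply: val_inj; rewrite !mk_vertexE.
Qed.

Lemma table_is_face2 (a : cell L 1) (x : 'I_n) :
  is_face a (x : cell L 2) <-> exists2 k, k < 3 & mk_edge x k = a.
Proof.
split=> [/is_face2P[k k3 <-]|[k k3 <-]]; first by exists k; rewrite ?table_edge_face.
by apply/is_face2P; exists k; rewrite ?table_edge_face.
Qed.

Lemma table_is_vertex2 (w : cell L 0) (x : 'I_n) :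
  is_vertex2 w (x : cell L 2) <-> exists2 k, k < 3 & mk_vertex x k = w.
Proof.
split=> [/is_vertex2P[k k3 <-]|[k k3 <-]]; first by exists k; rewrite ?table_vertex_face.
by apply/is_vertex2P; exists k; rewrite ?table_vertex_face.
Qed.

Lemma table_is_face1 (w : cell L 0) i k : i < n -> k < 3 ->
  is_face w (mk_edge i k : cell L 1) <->
  mk_vertex i (edge_lo k) = w \/ mk_vertex i (edge_hi k) = w.
Proof. by move=> i_n k3; rewrite is_face1P /= !edge_endE // !inordK. Qed.

Lemma table_adjacent i a b : i < n -> a < 3 -> b < 3 ->
  clos_refl_trans _ (@adjacent0 L) (mk_vertex i a) (mk_vertex i b).
Proof.
move=> i_n.
have adj k : k < 3 ->
    adjacent0 (mk_vertex i (edge_lo k) : cell L 0) (mk_vertex i (edge_hi k)) /\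
    adjacent0 (mk_vertex i (edge_hi k) : cell L 0) (mk_vertex i (edge_lo k)).
  by move=> k3; split; exists (mk_edge i k); [right|left]; rewrite /= !edge_endE // !inordK.
have [[a0 b0] [[a1 b1] [a2 b2]]] := (adj 0 isT, (adj 1 isT, adj 2 isT)).
by case: a b => [|[|[|//]]] [|[|[|//]]] _ _; first [exact: rt_refl | exact: rt_step].
Qed.

Lemma table_connected : connected L.
Proof.
move=> x w _; have [i [k [i_n k3 ->]]] := vertex_cellP x.
have [j [m [j_n m3 ew]]] := vertex_cellP w.
(* A triangle is coloured by whether its vertex 0 can be joined to [w]. Vertices of one triangle are
   joined to each other, so triangles with a common edge get the same colour. *)
have [c Hc] := prop_colouring (fun i => clos_refl_trans _ (@adjacent0 L) (mk_vertex i 0) w).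
have cc : c i = c j.
  have step i1 k1 j1 m1 : i1 < n -> k1 < 3 -> j1 < n -> m1 < 3 -> e i1 k1 = e j1 m1 ->
      c i1 -> c j1.
    move=> i1_n k13 j1_n m13 ee /Hc h; apply/Hc.
    have [/(mk_vertex_eq i1_n (edge_lo_lt k1) j1_n (edge_lo_lt m1)) el _] :=
      st_ends tab i1_n k13 j1_n m13 ee.
    apply: (rt_trans _ _ _ (mk_vertex j1 (edge_lo m1))).
      exact: table_adjacent (edge_lo_lt _).
    rewrite -el; apply: (rt_trans _ _ _ (mk_vertex i1 0)) => //.
    exact: table_adjacent (edge_lo_lt _) _.
  apply: (st_connected tab) => // i1 k1 j1 m1 i1_n k13 j1_n m13 ee.
  by apply/idP/idP; [apply: step ee | apply: step (esym ee)].
have : c i by rewrite cc; apply/Hc; rewrite ew; exact: table_adjacent.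
by move/Hc; apply: rt_trans; exact: table_adjacent.
Qed.

Lemma table_link (w : cell L 0) (x y : cell L 2) :
  is_vertex2 w x -> is_vertex2 w y -> clos_refl_trans _ (neighbours w) x y.
Proof.
move=> /table_is_vertex2[k k3 ew] /table_is_vertex2[m m3 ew'].
(* The triangles reached from [x] through [w]-neighbours; quantifying over the bound gives a
   predicate on all numbers, as a colouring requires. *)
pose P i := forall i_n : i < n, clos_refl_trans _ (@neighbours L w) x (Ordinal i_n).
have [c Hc] := prop_colouring P.
have cxy : c y = c x.
  apply: (st_link tab (ltn_ord x) k3 _ (ltn_ord y) m3); last first.
    by apply/(mk_vertex_eq (ltn_ord y) m3 (ltn_ord x) k3); rewrite ew'.
  have step i1 k1 j1 m1 (i1_n : i1 < n) : k1 < 3 -> j1 < n -> m1 < 3 -> e i1 k1 = e j1 m1 ->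
      v i1 (edge_lo k1) = v x k \/ v i1 (edge_hi k1) = v x k -> c i1 -> c j1.
    move=> k13 _ m13 ee wv /Hc h; apply/Hc => j1_n.
    apply: (rt_trans _ _ _ _ _ (h i1_n)); apply: rt_step.
    exists (mk_edge i1 k1); split.
    - apply/table_is_face1 => //; rewrite -ew.
      by case: wv => ev; [left|right]; apply/mk_vertex_eq; rewrite ?edge_lo_lt ?edge_hi_lt.
    - by apply/table_is_face2; exists k1.
    - by apply/table_is_face2; exists m1 => //; apply/mk_edge_eq.
  move=> i1 k1 j1 m1 i1_n k13 j1_n m13 ee wv; apply/idP/idP; first exact: step ee wv.
  (* The converse is the same step with the triangles exchanged; the condition that [w] lies on the
     edge is moved to the other triangle by [st_ends]. *)
  apply: (step _ m1 _ k1) => //.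
  by have [<- <-] := st_ends tab i1_n k13 j1_n m13 ee.
have : c x.
  by apply/Hc => x_n; rewrite (_ : Ordinal x_n = x); [exact: rt_refl | exact: val_inj].
rewrite -cxy => /Hc /(_ (ltn_ord y)).
by rewrite (_ : Ordinal _ = y) //; apply: val_inj.
Qed.

Lemma table_finite : exists s : seq {m : nat & cell L m}, forall c, c \in s.
Proof.
exists ([seq Tagged (cell L) (w : cell L 0) | w <- pmap insub table_vertices] ++
        [seq Tagged (cell L) (a : cell L 1) | a <- pmap insub table_edges] ++
        [seq Tagged (cell L) (x : cell L 2) | x <- ord_enum n]).
move=> [[|[|[|m]]] c] //; rewrite !mem_cat; apply/or3P.
- by apply: Or31; apply/map_f; rewrite mem_pmap_sub (valP c).
- by apply: Or32; apply/map_f; rewrite mem_pmap_sub (valP c).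
- by apply: Or33; apply/map_f; rewrite mem_ord_enum.
Qed.

Lemma table_sides (a : cell L 1) : exists x y : cell L 2,
  x <> y /\ forall z, is_face a z <-> z = x \/ z = y.
Proof.
have [i [k [i_n k3 ->]]] := edge_cellP a.
have [j [j_n nj [m m3 em] sides]] := st_sides tab i_n k3.
exists (Ordinal i_n), (Ordinal j_n); split; first by move=> [] /esym.
move=> z; rewrite table_is_face2; split=> [[m' m'3 /mk_edge_eq ee]|[] ->]; last 2 first.
- by exists k.
- by exists m => //; apply/mk_edge_eq.
have [] := sides z m' (ltn_ord z) m'3 (ee (ltn_ord z) m'3 i_n k3) => ez; [left|right];
  exact: val_inj.
Qed.

Lemma table_face2_inj (x : cell L 2) : injective (fun i => face L i x).
Proof.
have x_n : x < n := ltn_ord (x : 'I_n).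
move=> i j ee; apply: val_inj; apply: (e_inj x_n (ltn_ord i) (ltn_ord j)).
exact/(mk_edge_eq x_n (ltn_ord i) x_n (ltn_ord j)).
Qed.

Lemma table_face1_inj (a : cell L 1) : injective (fun i => face L i a).
Proof.
have [i [k [i_n k3 ->]]] := edge_cellP a => j l.
rewrite /= !edge_endE // => ee.
have : (if j == 0 :> nat then edge_hi else edge_lo) k =
       (if l == 0 :> nat then edge_hi else edge_lo) k.
  apply: (v_inj i_n); try by case: ifP; rewrite ?edge_lo_lt ?edge_hi_lt.
  by apply/mk_vertex_eq => //; case: ifP; rewrite ?edge_lo_lt ?edge_hi_lt.
case: j l {ee} => -[|[|//]] j2 [[|[|//]] l2] //=; try by move=> _; exact: val_inj.
  by case: k k3 => [|[|[|]]].
by case: k k3 => [|[|[|]]].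
Qed.

Lemma table_coeff_boundary (D : chain L 2) i k j m (i_n : i < n) (j_n : j < n) :
  k < 3 -> m < 3 -> i <> j -> e i k = e j m ->
  coeff (mk_edge i k : cell L 1) (boundary D) =
    ((-1) ^+ (k == 1)%N * coeff (Ordinal i_n : cell L 2) D +
     (-1) ^+ (m == 1)%N * coeff (Ordinal j_n : cell L 2) D)%R.
Proof.
move=> k3 m3 nij ee.
have sgn3 l : l < 3 -> ((-1) ^+ (l == 1)%N = (-1) ^+ l :> int)%R by case: l => [|[|[|l]]].
rewrite !sgn3 // -(table_edge_face (Ordinal i_n) k3).
apply: (coeff_boundary table_face2_inj) => //.
- by move=> [] /nij.
- by rewrite !table_edge_face //; apply/mk_edge_eq.
have [x [y [_ sides]]] := table_sides (tri_edge (Ordinal i_n : cell L 2) k).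
have fi : is_face (tri_edge (Ordinal i_n : cell L 2) k) (Ordinal i_n : cell L 2).
  by apply/is_face2P; exists k.
have fj : is_face (tri_edge (Ordinal i_n : cell L 2) k) (Ordinal j_n : cell L 2).
  by apply/table_is_face2; exists m => //; rewrite table_edge_face //; apply/mk_edge_eq.
have nxy : (Ordinal i_n : cell L 2) <> Ordinal j_n by move=> [].
move=> z; move: fi fj => /sides fi /sides fj /sides fz.
by case: fi fj fz nxy => -> [] -> [] ->; auto.
Qed.

(** The generator is the fundamental cycle [w], the sum of all triangles with the signs of a
    coherent orientation. It is a cycle because the two sides of each edge cancel. *)
Lemma table_H2 : exists2 g : {additive int -> chain L 2}, injective g &
  forall c : chain L 2, boundary c = 0%R <-> exists z, c = g z.
Proof.
have [s Hs] := st_orient tab.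
pose w : chain L 2 := (\sum_(x < n) << (-1) ^+ s x *g (x : cell L 2) >>)%R.
have coeff_w (x : 'I_n) : coeff (x : cell L 2) w = ((-1) ^+ s x)%R.
  rewrite raddf_sum /= (bigD1 x) //= coeffU eqxx mulr1 big1 ?addr0 // => y nyx.
  by rewrite coeffU (negPf nyx) mulr0.
have coeff_wz (x : 'I_n) z : coeff (x : cell L 2) (w *~ z)%R = (z * (-1) ^+ s x)%R.
  by rewrite raddfMz /= coeff_w -mulrzl intz.
pose x0 : 'I_n := Ordinal (st_pos tab).
exists ( *~%R w : {additive int -> chain L 2}).
  move=> z z' /(congr1 (coeff (x0 : cell L 2))); rewrite !coeff_wz.
  by apply: mulIf; rewrite signr_eq0.
move=> c; split=> [bc|[z ->]].
  exists (coeff (x0 : cell L 2) c * (-1) ^+ s x0)%R.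
  apply/eqP/freeg_eqP => x; rewrite coeff_wz.
  (* For a cycle, the coefficients corrected by the orientation are equal at the two sides of an
     edge. Colouring by agreement with the value at [x0] lets [st_connected] show that the cycle is
     a multiple of [w]. *)
  pose C i := if insub i is Some y then
    (coeff (y : cell L 2) c * (-1) ^+ s i == coeff (x0 : cell L 2) c * (-1) ^+ s x0)%R
    else false.
  have CE i (i_n : i < n) : C i = (coeff (Ordinal i_n : cell L 2) c * (-1) ^+ s i ==
      coeff (x0 : cell L 2) c * (-1) ^+ s x0)%R by rewrite /C insubT.
  have : C (x : 'I_n) = C x0.
    apply: (st_connected tab) => // i k j m i_n k3 j_n m3 ee.
    have [->//|/eqP nij] := eqVneq i j.
    have := table_coeff_boundary c i_n j_n k3 m3 nij ee; rewrite bc coeff0 !CE.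
    have := Hs i k j m i_n k3 j_n m3 nij ee.
    case: (s i); case: (s j); case: (k == 1); case: (m == 1) => //= _;
      by rewrite ?expr0 ?expr1 ?mul1r ?mulN1r ?mulrN1 ?mulr1 => h; congr (_ == _); lia.
  rewrite (CE _ (ltn_ord (x : 'I_n))) (CE _ (st_pos tab)) eqxx.
  have -> : Ordinal (ltn_ord (x : 'I_n)) = x by apply: val_inj.
  by move=> /eqP <-; rewrite -mulrA -signr_addb addbb mulr1.
apply/eqP/freeg_eqP => a; rewrite coeff0.
have [i [k [i_n k3 ->]]] := edge_cellP a.
have [j [j_n nj [m m3 em] _]] := st_sides tab i_n k3.
rewrite (table_coeff_boundary _ i_n j_n k3 m3) // 1?coeff_wz; last by move/esym.
rewrite coeff_wz /=; have := Hs i k j m i_n k3 j_n m3 (fun h => nj (esym h)) (esym em).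
by case: (s i); case: (s j); case: (k == 1); case: (m == 1) => //= _;
  rewrite ?expr0 ?expr1 ?mul1r ?mulN1r ?mulrN1 ?mulr1; lia.
Qed.

Lemma table_M_complex : M_complex L.
Proof.
have edge_vertices i k : i < n -> k < 3 ->
    exists2 m, m < 3 & is_face (mk_vertex i k : cell L 0) (mk_edge i m : cell L 1).
  move=> i_n; case: k => [|[|[|//]]] _; [exists 2|exists 2|exists 0] => //;
    by apply/table_is_face1 => //; auto.
split.
- exact: table_connected.
- exact: table_finite.
- by move=> [|[|[|m]]] // _ [].
- move=> w; have [i [k [i_n k3 ->]]] := vertex_cellP w.
  by have [m _ h] := edge_vertices i k i_n k3; exists (mk_edge i m).
- move=> a; have [i [k [i_n k3 ->]]] := edge_cellP a.
  by exists (Ordinal i_n); apply/table_is_face2; exists k.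
- exact: table_face2_inj.
- exact: table_face1_inj.
- exact: table_sides.
- exact: table_link.
- exact: table_H2.
Qed.

Definition table_label (z : cell L 0 + cell L 1) : W :=
  match z with inl w => val (w : vertex_cell) | inr a => val (a : edge_cell) end.

Lemma table_label_inj : injective table_label.
Proof.
have disj (w : vertex_cell) (a : edge_cell) : val w <> val a.
  have [i [k [i_n k3 ->]]] := vertex_cellP w; have [j [m [j_n m3 ->]]] := edge_cellP a.
  by rewrite mk_vertexE // mk_edgeE //; apply: (st_disjoint tab).
move=> [w|a] [w'|a'] /=.
- by move=> /val_inj ->.
- by move=> /disj.
- by move=> /esym /disj.
- by move=> /val_inj ->.
Qed.

End ComplexOfTable.

(** * Axioms (i) as tables of letters *)

Section SurfaceAxiom.
Variable W : countType.

Definition pickled (t : sextuple W) : seq nat := [seq choice.pickle a | a <- tval (val t)].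
Definition vertex_letter (ss : seq (seq nat)) i k := nth 0 (nth [::] ss i) k.
(** The shift by 3 is due to [nu], which lists the three vertices and then the edges opposite to
    them. *)
Definition edge_letter (ss : seq (seq nat)) i k := nth 0 (nth [::] ss i) (3 + k).

Lemma size_sextuple (t : sextuple W) : size (tval (val t)) = 6.
Proof. exact: size_tuple. Qed.

Lemma nu_vertex (L : delta_complex) lab (ML : M_complex L) (inj : injective lab) x k w0 :
  k < 3 -> nth w0 (tval (val (nu (W := W) ML inj x))) k = lab (inl (tri_vertex x k)).
Proof. by case: k => [|[|[|//]]]. Qed.

Lemma nu_edge (L : delta_complex) lab (ML : M_complex L) (inj : injective lab) x k w0 :
  k < 3 -> nth w0 (tval (val (nu (W := W) ML inj x))) (3 + k) = lab (inr (tri_edge x k)).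
Proof. by case: k => [|[|[|//]]]. Qed.

Lemma sextuple_eq (t t' : sextuple W) :
  (forall w0 k, k < 3 -> nth w0 (tval (val t)) k = nth w0 (tval (val t')) k /\
    nth w0 (tval (val t)) (3 + k) = nth w0 (tval (val t')) (3 + k)) -> t = t'.
Proof.
move=> H; apply: val_inj; apply: val_inj.
have [w0 _] : exists w0 : W, true.
  by have := size_sextuple t; case: (tval (val t)) => // w0; exists w0.
apply: (@eq_from_nth _ w0); rewrite !size_sextuple // => i i6.
have [i3|i3] := ltnP i 3; first by case: (H w0 i i3).
by have := H w0 (i - 3); rewrite subnKC // => -[|//]; rewrite ltn_subLR.
Qed.

Lemma surface_axiom_table (ts : seq (sextuple W)) :
  surface_axiom [seq Atom t | t <- ts] ->
  surface_table (size ts) (vertex_letter (map pickled ts)) (edge_letter (map pickled ts)).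
Proof.
move=> [L [lab [ML [inj [L2 [un full ets]]]]]].
have {ets} -> : ts = [seq nu ML inj x | x <- L2].
  by apply: (@inj_map _ _ (@Atom W)); [move=> ? ? [] | rewrite ets -map_comp].
have [x0 _] := M_complex_cell2 ML; rewrite size_map.
apply: surface_table_mono (complex_table ML un full x0) => i k j m i_n k3 j_n m3.
have vE i' k' : i' < size L2 -> k' < 3 ->
    vertex_letter (map pickled [seq nu ML inj x | x <- L2]) i' k' =
    choice.pickle (lab (inl (tri_vertex (nth x0 L2 i') k'))).
  move=> hi hk; rewrite /vertex_letter (nth_map (nu ML inj x0)) ?size_map //.
  set w0 := lab (inl (tri_vertex (nth x0 L2 i') k')).
  rewrite (nth_map w0) ?size_sextuple ?(ltn_trans hk) // (nth_map x0) //.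
  by rewrite nu_vertex.
have eE i' k' : i' < size L2 -> k' < 3 ->
    edge_letter (map pickled [seq nu ML inj x | x <- L2]) i' k' =
    choice.pickle (lab (inr (tri_edge (nth x0 L2 i') k'))).
  move=> hi hk; rewrite /edge_letter (nth_map (nu ML inj x0)) ?size_map //.
  set w0 := lab (inl (tri_vertex (nth x0 L2 i') k')).
  rewrite (nth_map w0) ?size_sextuple ?ltn_add2l // (nth_map x0) //.
  by rewrite nu_edge.
have pl : injective (fun z => choice.pickle (lab z)).
  by move=> z z' /(pcan_inj choice.pickleK) /inj.
rewrite !vE // !eE //.
by split; split=> [->//|/pl].
Qed.

(** The numbers are read back as letters, and the complex built from that table has letters as its
    0-cells and 1-cells, so the inclusion is the labelling. Distinctness of the six letters of an
    atom gives the injectivity within each triangle. *)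
Lemma table_surface_axiom (ts : seq (sextuple W)) :
  surface_table (size ts) (vertex_letter (map pickled ts)) (edge_letter (map pickled ts)) ->
  surface_axiom [seq Atom t | t <- ts].
Proof.
move=> tab0; have := st_pos tab0; case E : ts => [//|t0 ts'] _; rewrite -E.
case Et : (tval (val t0)) => [|w0 s]; first by have := size_sextuple t0; rewrite Et.
pose v i k := nth w0 (tval (val (nth t0 ts i))) k.
pose e i k := nth w0 (tval (val (nth t0 ts i))) (3 + k).
have tab : surface_table (size ts) v e.
  apply: surface_table_mono tab0 => i k j m i_n k3 j_n m3.
  have nthE i' k' : i' < size ts -> k' < 6 ->
      nth 0 (nth [::] (map pickled ts) i') k' =
      choice.pickle (nth w0 (tval (val (nth t0 ts i'))) k').
    by move=> hi hk; rewrite (nth_map t0) // (nth_map w0) ?size_sextuple.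
  rewrite /vertex_letter /edge_letter !nthE //; try exact: ltn_trans k3 _; try exact: ltn_trans m3 _.
  by split; split=> [/(pcan_inj choice.pickleK)//|]; rewrite /v /e => ->.
have v_inj i k m : i < size ts -> k < 3 -> m < 3 -> v i k = v i m -> k = m.
  move=> i_n k3 m3 /eqP; rewrite nth_uniq ?size_sextuple ?(ltn_trans k3) ?(ltn_trans m3) //.
    by move/eqP.
  exact: (valP (nth t0 ts i)).
have e_inj i k m : i < size ts -> k < 3 -> m < 3 -> e i k = e i m -> k = m.
  move=> i_n k3 m3 /eqP; rewrite nth_uniq ?size_sextuple ?ltn_add2l //.
    by rewrite eqn_add2l => /eqP.
  exact: (valP (nth t0 ts i)).
pose ML := table_M_complex tab v_inj e_inj.
exists (table_complex tab), (table_label (tab := tab)), ML, (@table_label_inj _ _ _ _ tab).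
exists (ord_enum (size ts)); split.
- exact: ord_enum_uniq.
- by move=> x; rewrite mem_ord_enum.
rewrite (map_comp _ (nu _ _)); congr map.
have ets : ts = [seq nth t0 ts (val i) | i <- ord_enum (size ts)].
  by rewrite (map_comp (nth t0 ts)) val_ord_enum -/(mkseq _ _) mkseq_nth.
rewrite [LHS]ets; apply: eq_map => i; apply: sextuple_eq => w k k3.
rewrite nu_vertex // nu_edge // (table_vertex_face tab) // (table_edge_face tab) // /table_label.
have i_n := ltn_ord (i : 'I_(size ts)).
have lt6 l : l < 6 -> l < size (tval (val (nth t0 ts (val i)))) by rewrite size_sextuple.
rewrite mk_vertexE // mk_edgeE // /v /e.
by split; apply: set_nth_default; apply: lt6; first exact: ltn_trans k3 _.
Qed.

End SurfaceAxiom.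

(** * The decision procedure *)

Section SurfaceTest.

Fixpoint lists_upto (T : Type) (F : seq T) n : seq (seq T) :=
  if n is n'.+1 then
    [::] :: flatten [seq [seq a :: l | l <- lists_upto F n'] | a <- F]
  else [:: [::]].

Lemma mem_lists_upto (T : eqType) (F : seq T) n l :
  (l \in lists_upto F n) = (size l <= n) && all (mem F) l.
Proof.
elim: n l => [|n IH] [|a l] //=; rewrite inE /= ltnS.
apply/flattenP/idP => [[_ /mapP[b bF ->] /mapP[l' + [-> ->]]]|].
  by rewrite IH => /andP[-> ->]; rewrite andbT.
rewrite andbCA => /andP[aF]; rewrite -IH => hl.
by exists [seq a :: l | l <- lists_upto F n]; [exact: map_f | exact: map_f].
Qed.

Definition all_flags n (P : nat -> nat -> bool) : bool :=
  all (fun i => all (fun k => P i k) (iota 0 3)) (iota 0 n).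

Lemma all_flagsP n (P : nat -> nat -> bool) :
  reflect (forall i k, i < n -> k < 3 -> P i k) (all_flags n P).
Proof.
apply: (iffP allP) => [H i k i_n k3|H i].
  by have /allP := H i ltac:(by rewrite mem_iota); apply; rewrite mem_iota.
by rewrite mem_iota => i_n; apply/allP => k; rewrite mem_iota; apply: H.
Qed.

(** Shorter lists are kept: read with the default [false] they are colourings too, so they impose
    nothing new. *)
Definition colourings n := lists_upto [:: true; false] n.

Lemma mem_colourings n (c : nat -> bool) : mkseq c n \in colourings n.
Proof.
by rewrite mem_lists_upto size_mkseq leqnn; apply/allP => -[]; rewrite !inE.
Qed.

(** The fields of [surface_table] with bounded quantifiers, [st_disjoint] and [st_ends] sharing one
    loop. A colouring may be restricted to the triangles, since its other values are never
    consulted. *)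
Definition surface_test (ss : seq (seq nat)) : bool :=
  let n := size ss in let v := vertex_letter ss in let e := edge_letter ss in
  [&& 0 < n,
   all_flags n (fun i k => all_flags n (fun j m => (v i k != e j m) &&
     ((e i k == e j m) ==> (v i (edge_lo k) == v j (edge_lo m)) &&
                           (v i (edge_hi k) == v j (edge_hi m))))),
   all_flags n (fun i k => has (fun j => [&& j != i,
     has (fun m => e j m == e i k) (iota 0 3) &
     all_flags n (fun j' m => (e j' m == e i k) ==> (j' == i) || (j' == j))]) (iota 0 n)),
   all (fun c => all_flags n (fun i0 k0 =>
     all_flags n (fun i k => all_flags n (fun j m => (e i k == e j m) &&
       ((v i (edge_lo k) == v i0 k0) || (v i (edge_hi k) == v i0 k0)) ==>
       (nth false c i == nth false c j))) ==>
     all_flags n (fun j m => (v j m == v i0 k0) ==> (nth false c j == nth false c i0))))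
     (colourings n),
   all (fun c =>
     all_flags n (fun i k => all_flags n (fun j m => (e i k == e j m) ==>
       (nth false c i == nth false c j))) ==>
     all (fun i => all (fun j => nth false c i == nth false c j) (iota 0 n)) (iota 0 n))
     (colourings n) &
   has (fun c => all_flags n (fun i k => all_flags n (fun j m =>
     (i != j) && (e i k == e j m) ==>
     (nth false c i (+) (k == 1) != nth false c j (+) (m == 1))))) (colourings n)].

Lemma surface_testP ss :
  reflect (surface_table (size ss) (vertex_letter ss) (edge_letter ss)) (surface_test ss).
Proof.
rewrite /surface_test; set n := size ss; set v := vertex_letter ss; set e := edge_letter ss.
apply: (iffP andP) => [[n0 /and5P[/all_flagsP H1 /all_flagsP H2 /allP H3 /allP H4]]|].
  move=> /hasP[s _ /all_flagsP H5].
  have H1' i k j m : i < n -> k < 3 -> j < n -> m < 3 -> (v i k != e j m) &&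
     ((e i k == e j m) ==> (v i (edge_lo k) == v j (edge_lo m)) &&
                           (v i (edge_hi k) == v j (edge_hi m))).
    by move=> i_n k3 j_n m3; have /all_flagsP := H1 i k i_n k3; apply.
  split=> //.
  - by move=> i k j m i_n k3 j_n m3; have /andP[/eqP] := H1' i k j m i_n k3 j_n m3.
  - move=> i k j m i_n k3 j_n m3 ee; have /andP[_] := H1' i k j m i_n k3 j_n m3.
    by rewrite ee eqxx => /andP[/eqP -> /eqP ->].
  - move=> i k i_n k3; have /hasP[j] := H2 i k i_n k3; rewrite mem_iota => j_n.
    move=> /and3P[/eqP nj /hasP[m +/eqP em] /all_flagsP sides]; rewrite mem_iota => m3.
    exists j; split=> //; first by exists m.
    move=> j' m' j'_n m'3 ee; have := sides j' m' j'_n m'3.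
    by rewrite ee eqxx => /orP[] /eqP; auto.
  - move=> i0 k0 c i0_n k03 Hc j m j_n m3 ev.
    have /all_flagsP /(_ i0 k0 i0_n k03) /implyP h := H3 _ (mem_colourings n c).
    lapply h => {h}.
      move=> /all_flagsP /(_ j m j_n m3); rewrite ev eqxx => /eqP.
      by rewrite !nth_mkseq.
    apply/all_flagsP => i k i_n k3; apply/all_flagsP => j' m' j'_n m'3.
    apply/implyP => /andP[/eqP ee wv]; rewrite !nth_mkseq //; apply/eqP.
    by apply: (Hc i k j' m') => //; case/orP: wv => /eqP; auto.
  - move=> c Hc i j i_n j_n.
    have /implyP h := H4 _ (mem_colourings n c); lapply h => {h}.
      move=> /allP /(_ i); rewrite mem_iota => /(_ i_n) /allP /(_ j).
      by rewrite mem_iota => /(_ j_n) /eqP; rewrite !nth_mkseq.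
    apply/all_flagsP => {}i k {}i_n k3; apply/all_flagsP => j' m' j'_n m'3.
    by apply/implyP => /eqP ee; rewrite !nth_mkseq //; apply/eqP/(Hc i k j' m').
  - exists (nth false s) => i k j m i_n k3 j_n m3 nij ee.
    have /all_flagsP /(_ j m j_n m3) := H5 i k i_n k3.
    by rewrite ee eqxx andbT (introN eqP nij) => /eqP.
case=> n0 S2 S3 S4 S5 S6 [s S7]; split=> //; apply/and5P; split.
- apply/all_flagsP => i k i_n k3; apply/all_flagsP => j m j_n m3.
  apply/andP; split; first by apply/eqP/S2.
  by apply/implyP => /eqP /S3 [] // -> ->; rewrite !eqxx.
- apply/all_flagsP => i k i_n k3; have [j [j_n nj [m m3 em] sides]] := S4 i k i_n k3.
  apply/hasP; exists j; rewrite ?mem_iota //; apply/and3P; split; first exact/eqP.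
    by apply/hasP; exists m; rewrite ?mem_iota // em.
  apply/all_flagsP => j' m' j'_n m'3; apply/implyP => /eqP /sides[] // ->;
    by rewrite eqxx ?orbT.
- apply/allP => c _; apply/all_flagsP => i0 k0 i0_n k03; apply/implyP => /all_flagsP H.
  apply/all_flagsP => j m j_n m3; apply/implyP => /eqP ev; apply/eqP.
  apply: (S5 i0 k0 (nth false c) i0_n k03 _ j m j_n m3 ev) => i k j' m' i_n k3 j'_n m'3 ee wv.
  have /all_flagsP /(_ j' m' j'_n m'3) := H i k i_n k3.
  by rewrite ee eqxx /= => /implyP h; apply/eqP/h; case: wv => ->; rewrite eqxx ?orbT.
- apply/allP => c _; apply/implyP => /all_flagsP H.
  apply/allP => i; rewrite mem_iota => i_n; apply/allP => j; rewrite mem_iota => j_n.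
  apply/eqP; apply: (S6 (nth false c)) => // {i i_n j j_n} i k j m i_n k3 j_n m3 ee.
  by have /all_flagsP /(_ j m j_n m3) := H i k i_n k3; rewrite ee eqxx => /eqP.
- apply/hasP; exists (mkseq s n); first exact: mem_colourings.
  apply/all_flagsP => i k i_n k3; apply/all_flagsP => j m j_n m3.
  apply/implyP => /andP[/eqP nij /eqP ee]; rewrite !nth_mkseq //; apply/eqP.
  exact: (S7 i k j m).
Qed.

End SurfaceTest.

Section ComputableTest.
Context X `{encodable X}.

Lemma computable_lists_upto (T : eqType) `{encodable T} (F : X -> seq T) n :
  computable F -> computable n -> computable (fun x => lists_upto (F x) (n x)).
Proof.
move=> cF cn; apply: (computable_ext (f := fun x => iter (n x) (fun r =>
  [::] :: flatten [seq [seq a :: l | l <- r] | a <- F x]) [:: [::]])).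
  by move=> x; elim: (n x) => //= k ->.
apply: (computable_iter (g := fun x r =>
  [::] :: flatten [seq [seq a :: l | l <- r] | a <- F x])); comp.
by apply: computable_flatten; comp.
Qed.

Lemma computable_all_flags (n : X -> nat) (P : X -> nat -> nat -> bool) :
  computable n -> computable (fun z : X * nat * nat => P z.1.1 z.1.2 z.2) ->
  computable (fun x => all_flags (n x) (P x)).
Proof.
move=> cn cP; rewrite /all_flags; comp; first by apply: computable_iota; comp.
Qed.

End ComputableTest.

Lemma computable_leq X `{encodable X} (f g : X -> nat) :
  computable f -> computable g -> computable (fun x => f x <= g x).
Proof. by move=> cf cg; rewrite /leq; comp. Qed.

Ltac computable_lists :=
  lazymatch goal with
  | |- computable (fun x => _ <= _) => apply: computable_leq
  | |- computable (fun x => _ \in _) => apply: computable_mem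
  | |- computable (fun x => iota _ _) => apply: computable_iota
  | |- computable (fun x => flatten _) => apply: computable_flatten
  | |- computable (fun x => perm_eq _ _) => apply: computable_perm_eq
  | |- computable (fun x => lists_upto _ _) => apply: computable_lists_upto
  | |- computable (fun x => all_flags _ _) => apply: computable_all_flags
  | |- computable (fun x => iter _ _ _) => apply: computable_iter
  | _ => computable_seq2
  end.
Ltac computable_step ::= computable_lists.

Lemma computable_surface_test X `{encodable X} (ss : X -> seq (seq nat)) :
  computable ss -> computable (fun x => surface_test (ss x)).
Proof.
move=> css; rewrite /surface_test /colourings /vertex_letter /edge_letter /edge_lo /edge_hi.
by comp.
Qed.

(** Passing to a tail is not structural recursion on the number, hence the fuel. The number itself
    is enough, as the code of a tail is smaller. *)
Fixpoint decode_fuel (k n : nat) : seq nat :=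
  if k is k'.+1 then
    if n is m.+1 then fstn m :: decode_fuel k' (sndn m) else [::]
  else [::].

Definition decode n := decode_fuel n n.

Lemma decodeK : cancel decode code_seq.
Proof.
have leq_sndn m : sndn m <= m.
  by rewrite -{2}(pairn_fst_snd m); apply: leq_trans (leq_addl _ _) (leq_pairn _ _).
move=> n; rewrite /decode; have: n <= n by []; move: {2 3}n => k.
elim: k n => [|k IH] [|n] //=; rewrite ltnS => nk.
by rewrite IH ?pairn_fst_snd // (leq_trans (leq_sndn n)).
Qed.

Lemma code_seqK : cancel code_seq decode.
Proof. by move=> s; apply: code_seq_inj; rewrite decodeK. Qed.

(** Every number is the code of a list of numbers, so on the level of codes [decode] is the identity
    and the same recursive function serves. *)
Lemma computable_decode X `{encodable X} (f : X -> nat) :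
  computable f -> computable (fun x => decode (f x)).
Proof.
move=> [g rg hg]; exists g => // x; rewrite hg -[LHS]decodeK.
by rewrite -[X in code_seq X](map_id (decode _)).
Qed.

Lemma computable_code_seq X `{encodable X} (f : X -> seq nat) :
  computable f -> computable (fun x => code_seq (f x)).
Proof.
move=> [g rg hg]; exists g => // x; rewrite hg.
by rewrite -[X in _ = enc (code_seq X)]map_id.
Qed.

Ltac computable_codes :=
  lazymatch goal with
  | |- computable (fun x => decode _) => apply: computable_decode
  | |- computable decode => exact: (computable_decode (@computable_id nat _))
  | |- computable (fun x => code_seq _) => apply: computable_code_seq
  | _ => computable_lists
  end.
Ltac computable_step ::= computable_codes.

(** * The program on codes *)

Section Program.

Definition is_atom_code c := fstn c == 0.
Definition children c : seq nat :=
  if is_atom_code c then [::] else [:: fstn (sndn c); sndn (sndn c)].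

(* The code of the sequent is enough iterations, since it bounds the depth of
   its formulae. *)
Definition subformula_codes (s : seq nat) : seq nat :=
  iter (code_seq s) (fun l => l ++ flatten (map children l)) s.

Definition letters_of (s : seq nat) : seq nat :=
  flatten [seq decode (sndn c) | c <- subformula_codes s & is_atom_code c].

(** The counting condition says that no letter is repeated, in terms of operations already known to
    be computable. *)
Definition atom_codes (s : seq nat) : seq nat :=
  [seq pairn 0 (code_seq w) | w <- lists_upto (letters_of s) 6 &
    (size w == 6) && all (fun a => count (fun b => b == a) w == 1) w].

Definition formula_codes s := subformula_codes s ++ atom_codes s.
Definition sequent_codes s := lists_upto (formula_codes s) (size s).

Definition relabel_code (k : seq nat) c :=
  pairn 0 (code_seq [seq nth 0 (decode (sndn c)) i | i <- k]).

Definition axiom_code (u : seq nat) : bool :=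
  (all is_atom_code u && surface_test [seq decode (sndn c) | c <- u]) ||
  has (fun c => has (fun k => is_atom_code c && perm_eq u [:: c; relabel_code k c])
    relabellings) u.

Definition inferred s (T : seq (seq nat)) (u : seq nat) : bool :=
  axiom_code u || has (fun G => has (fun D =>
    [&& G \in T, D \in T & perm_eq u (G ++ D)] ||
    has (fun p => has (fun q => [||
      [&& is_atom_code p, p :: G \in T, p :: D \in T & perm_eq u (G ++ D)],
      [&& p :: G \in T, q :: G \in T & perm_eq u (pairn 1 (pairn p q) :: G)] |
      [&& p :: G \in T, q :: D \in T & perm_eq u (pairn 2 (pairn p q) :: G ++ D)]])
    (formula_codes s)) (formula_codes s)) (sequent_codes s)) (sequent_codes s).

(** Each round filters the whole universe afresh; as [inferred] is monotone in [T], the rounds still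
    increase without a union with [T]. *)
Definition saturation_step s T := filter (inferred s T) (sequent_codes s).
(** Every round before stabilisation gains an entry of the universe, so its size is a sufficient
    number of rounds. *)
Definition decide s : bool :=
  s \in iter (size (sequent_codes s)) (saturation_step s) [::].

Lemma computable_formula_codes X `{encodable X} (s : X -> seq nat) :
  computable s -> computable (fun x => formula_codes (s x)).
Proof.
move=> cs.
have c1 : computable (fun x => subformula_codes (s x)).
  rewrite /subformula_codes /children /is_atom_code; comp.
rewrite /formula_codes /atom_codes /letters_of /is_atom_code; comp.
Qed.

Ltac computable_program :=
  lazymatch goal with
  | |- computable (fun x => formula_codes _) => apply: computable_formula_codes
  | |- computable (fun x => surface_test _) => apply: computable_surface_test
  | _ => computable_codes
  end.
Ltac computable_step ::= computable_program.

Lemma computable_decide : computable decide.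
Proof.
rewrite /decide /saturation_step /inferred /axiom_code /relabel_code /is_atom_code.
rewrite /sequent_codes.
comp.
- exact (computable_formula_codes (@computable_id (seq nat) _)).
- exact (computable_size (@computable_id (seq nat) _)).
Qed.

End Program.

(** * Correctness of the decision procedure *)

Section Saturation.
Variables (A : eqType) (U : seq A) (Q : seq A -> pred A).
Hypothesis Q_mono : forall T T' : seq A, {subset T <= T'} -> subpred (Q T) (Q T').
Local Notation stage k := (iter k (fun T => filter (Q T) U) [::]).

Lemma stage_mono k : {subset stage k <= stage k.+1}.
Proof.
elim: k => [|k IH] // x; rewrite !iterS mem_filter => /andP[qx xU].
by rewrite mem_filter xU (Q_mono IH).
Qed.

Lemma stage_leq k m : k <= m -> {subset stage k <= stage m}.
Proof.
move/subnK <-; elim: (m - k) => // d IH x /IH; exact: stage_mono.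
Qed.

(** Both stages are filters of the same list, the earlier by the stronger predicate, hence a
    subsequence of the later; equal sizes then force equality, even if [U] has repetitions. *)
Lemma stage_grows k : stage k.+1 = stage k \/ size (stage k) < size (stage k.+1).
Proof.
suff sub : subseq (stage k) (stage k.+1).
  have [h1 h2] := size_subseq_leqif sub.
  have [e|ne] := eqVneq (stage k) (stage k.+1); first by left.
  by right; rewrite ltn_neqAle h1 h2 ne.
case: k => [|k]; first exact: sub0seq.
rewrite !iterS; set T := iter k _ _; set T' := filter (Q T) U.
have {1}-> : T' = filter (Q T) (filter (Q T') U).
  rewrite -filter_predI; apply: eq_filter => x /=.
  case qx : (Q T x) => //=; apply/esym; apply: Q_mono qx; exact: (@stage_mono k).
exact: filter_subseq.
Qed.

Lemma stage_sat k : {subset stage k <= stage (size U)}.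
Proof.
(* Either the stages have stopped changing by round [m], or each round so far added an entry; for
   [m] equal to [size U] the latter would overfill [U]. *)
have grow m : stage m.+1 = stage m \/ m < size (stage m.+1).
  elim: m => [|m [IH|IH]]; first by have [] := stage_grows 0; auto.
    by left; rewrite iterS IH.
  by have [|h] := stage_grows m.+1; [left | right; apply: leq_ltn_trans h].
have fix_ : stage (size U).+1 = stage (size U).
  have [//|] := grow (size U); rewrite iterS size_filter => h.
  by have := count_size (Q (stage (size U))) U; rewrite leqNgt h.
have fixd d : stage (d + size U) = stage (size U).
  by elim: d => // d IH; rewrite addSn iterS IH; exact: fix_.
move=> x /(stage_leq (leq_addr (size U) k)); by rewrite fixd.
Qed.

End Saturation.

(** * No letter occurs in exactly one formula *)

Section Letters.
Variable W : countType.
Implicit Types (p q : formula W) (t : sextuple W) (S : seq (formula W)).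

Lemma atoms_of S : all (@is_atom W) S -> exists ts, S = [seq Atom t | t <- ts].
Proof.
elim: S => [|[t|//|//] S IH] /=; first by exists [::].
by move=> /IH[ts ->]; exists (t :: ts).
Qed.

Fixpoint formula_letters p : seq W :=
  match p with
  | Atom t => tval (val t)
  | Dia p q | Iff p q => formula_letters p ++ formula_letters q
  end.

(** The triangle on the other side of an edge shares that edge and, by [st_ends], its two ends.
    Vertices 0 and 1 are the ends of edge 2, and vertex 2 is the upper end of edge 0. *)
Lemma surface_table_shared (T : Type) n (v e : nat -> nat -> T) i k :
  surface_table n v e -> i < n -> k < 3 ->
  (exists j m, [/\ j < n, m < 3, j <> i & v j m = v i k]) /\
  (exists j m, [/\ j < n, m < 3, j <> i & e j m = e i k]).
Proof.
move=> tab i_n k3; split; last first.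
  by have [j [j_n nj [m m3 em] _]] := st_sides tab i_n k3; exists j, m.
have end_shared k' : k' < 3 -> exists2 j, j < n /\ j <> i & exists2 m, m < 3 &
    v j (edge_lo m) = v i (edge_lo k') /\ v j (edge_hi m) = v i (edge_hi k').
  move=> k'3; have [j [j_n nj [m m3 em] _]] := st_sides tab i_n k'3.
  by exists j => //; exists m => //; apply: (st_ends tab).
case: k k3 => [|[|[|//]]] _.
- have [j [j_n nj] [m m3 [h _]]] := end_shared 2 isT.
  by exists j, (edge_lo m); rewrite edge_lo_lt.
- have [j [j_n nj] [m m3 [_ h]]] := end_shared 2 isT.
  by exists j, (edge_hi m); rewrite edge_hi_lt.
- have [j [j_n nj] [m m3 [_ h]]] := end_shared 0 isT.
  by exists j, (edge_hi m); rewrite edge_hi_lt.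
Qed.

(** Phrased with positions instead of members, because the same formula may occur twice in a
    sequent. *)
Lemma count_neq1 (T : eqType) (a : pred T) x0 s i j : i < size s -> j < size s -> j <> i ->
  a (nth x0 s i) -> a (nth x0 s j) -> count a s != 1.
Proof.
move=> hi hj nji ai aj; rewrite -[s in count a s](mkseq_nth x0) count_map -size_filter.
set l := filter _ _; have : size [:: i; j] <= size l.
  apply: uniq_leq_size => [|x]; first by rewrite /= inE eq_sym; apply/andP; split => //; apply/eqP.
  by rewrite !inE mem_filter mem_iota /= => /orP[] /eqP ->; rewrite ?ai ?aj.
by rewrite /=; case: (size l) => [|[|]].
Qed.

Lemma surface_letters S a :
  surface_axiom S -> count (fun p => a \in formula_letters p) S != 1.
Proof.
move=> sS; have [ts eS] := atoms_of (surface_axiom_atoms sS).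
rewrite {}eS in sS *; have tab := surface_axiom_table sS; rewrite count_map.
case hS : (has [pred t | a \in tval (val t)] ts); last first.
  by move: hS; rewrite has_count; case: (count _ _).
case/hasP: hS => t0 /(nthP t0)[i i_n <-] /=.
have mem_pickled j : (a \in tval (val (nth t0 ts j))) = (choice.pickle a \in pickled (nth t0 ts j)).
  by rewrite mem_map //; exact: pcan_inj choice.pickleK.
have size_pickled t : size (pickled t) = 6 by rewrite size_map size_sextuple.
rewrite mem_pickled => /(nthP 0)[l]; rewrite size_pickled => l6 el.
have [j [m [j_n nj m6 em]]] : exists j m, [/\ j < size ts, j <> i, m < 6 &
    nth 0 (pickled (nth t0 ts j)) m = choice.pickle a].
  have [l3|l3] := ltnP l 3.
    have [[j [m [j_n m3 nj em]]] _] := surface_table_shared tab i_n l3.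
    exists j, m; rewrite (ltn_trans m3) //; split=> //.
    by move: em; rewrite /vertex_letter !(nth_map t0) // el.
  have l3' : l - 3 < 3 by rewrite ltn_subLR.
  have [_ [j [m [j_n m3 nj em]]]] := surface_table_shared tab i_n l3'.
  exists j, (3 + m); split=> //.
  by move: em; rewrite /edge_letter !(nth_map t0) // subnKC // el.
apply: (@count_neq1 _ _ t0 _ i j) => //=; rewrite mem_pickled.
  by rewrite -el mem_nth ?size_pickled.
by rewrite -em mem_nth ?size_pickled.
Qed.

Lemma relabelled_mem k t t' a : k \in relabellings -> relabelled k t t' ->
  (a \in tval (val t')) = (a \in tval (val t)).
Proof.
move=> kr /(_ a) ->; case: t => -[[|A [|B [|C [|P [|Q [|R [|]]]]]]] //= st] ut.
by move: kr; rewrite !inE => /orP[] /eqP -> /=; rewrite !inE;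
  case: (a == A); case: (a == B); case: (a == C); case: (a == P); case: (a == Q);
  case: (a == R).
Qed.

(** A letter of the cut atom occurs in both contexts, hence at least twice in the conclusion. For a
    letter outside it, the two counts add up, and numbers different from 1 never sum to 1. The
    introductions are settled by the same arithmetic. *)
Lemma nd_letters S a : nd S -> count (fun p => a \in formula_letters p) S != 1.
Proof.
have cp (P : pred (formula W)) u u' : perm_eq u u' -> count P u = count P u' by move/permP.
elim=> {S}.
- by move=> u; exact: surface_letters.
- move=> k t t' u kr kt /cp -> /=; rewrite (relabelled_mem _ kr kt).
  by case: (a \in _).
- by move=> G D t u _ /= + _ + /cp ->; rewrite count_cat; lia.
- by move=> G D u _ + _ + /cp ->; rewrite count_cat; lia.
- by move=> G p q u _ /= + _ + /cp -> /=; rewrite mem_cat; do 2 case: (a \in _); lia.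
- by move=> G D p q u _ /= + _ + /cp -> /=; rewrite mem_cat count_cat; do 2 case: (a \in _); lia.
Qed.

End Letters.

(** * Stages of the saturation and derivations *)

Section Correctness.
Variable W : countType.
Implicit Types (p q : formula W) (t : sextuple W) (S G D : seq (formula W)).
Local Notation code := (@code_formula W).

Lemma code_atom t : code (Atom t) = pairn 0 (code_seq (pickled t)).
Proof. by []. Qed.

Lemma pickled_inj : injective (@pickled W).
Proof.
move=> t t' /(inj_map (pcan_inj choice.pickleK)) e.
by do 2 apply: val_inj.
Qed.

Lemma code_formula_inj : injective code.
Proof.
elim=> [t|p IHp q IHq|p IHp q IHq] [t'|p' q'|p' q'] /pairn_inj[] // _.
- by move=> /code_seq_inj /pickled_inj ->.
- by move=> /pairn_inj[/IHp -> /IHq ->].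
- by move=> /pairn_inj[/IHp -> /IHq ->].
Qed.

Lemma is_atom_codeE p : is_atom_code (code p) = is_atom p.
Proof. by case: p => *; rewrite /is_atom_code /= fstnK. Qed.

Lemma decode_atom t : decode (sndn (code (Atom t))) = pickled t.
Proof. by rewrite /= sndnK -/(pickled t) code_seqK. Qed.

Lemma decode_atoms (ts : seq (sextuple W)) :
  [seq decode (sndn c) | c <- map code [seq Atom t | t <- ts]] = map (@pickled W) ts.
Proof. by rewrite -!map_comp; apply: eq_map => t; rewrite /= decode_atom. Qed.

Lemma relabel_codeP k t t' : all (fun i => i < 6) k ->
  relabel_code k (code (Atom t)) = code (Atom t') <-> relabelled k t t'.
Proof.
move=> k6; rewrite /relabel_code decode_atom code_atom.
have kE w0 : [seq nth 0 (pickled t) i | i <- k] =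
    map choice.pickle [seq nth w0 (tval (val t)) i | i <- k].
  rewrite -map_comp; apply/eq_in_map => i /(allP k6) i6 /=.
  by rewrite (nth_map w0) ?size_sextuple.
split=> [/pairn_inj[_ /code_seq_inj] h w0|/= h].
  by move: h; rewrite (kE w0) => /(inj_map (pcan_inj choice.pickleK)).
have [w0 _] : exists w0 : W, true.
  by have := size_sextuple t; case: (tval (val t)) => // w0; exists w0.
by rewrite (kE w0) -h.
Qed.

Lemma relabellings_lt6 k : k \in relabellings -> all (fun i => i < 6) k.
Proof. by rewrite !inE => /orP[] /eqP ->. Qed.

Lemma axiom_code_sound S : axiom_code (map code S) -> nd S.
Proof.
case/orP => [/andP[aS /surface_testP]|/hasP[c /mapP[p pS ->] /hasP[k kr /andP[ap pe]]]].
  rewrite all_map (eq_all is_atom_codeE) in aS.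
  have [ts ->] := atoms_of aS; rewrite decode_atoms size_map => tab.
  by apply: nd_surface; apply: table_surface_axiom.
(* That the relabelled number codes a formula is not evident from its form; it follows from its
   occurrence in [S], and the tag 0 then makes this formula an atom. *)
have : relabel_code k (code p) \in map code S by rewrite (perm_mem pe) !inE eqxx orbT.
case/mapP => q qS eq; rewrite eq in pe.
have : perm_eq (map code S) (map code [:: p; q]) by [].
move/(perm_map_inj code_formula_inj) => pS'.
move: ap eq pS'; rewrite is_atom_codeE; case: p {pe pS} => // t _.
case: q qS => [t'|p q|p q] _; last 2 first.
- by move=> /pairn_inj[].
- by move=> /pairn_inj[].
by move/(relabel_codeP _ _ (relabellings_lt6 kr)) => kt; apply: nd_relabel kr kt.
Qed.

Lemma axiom_code_surface S : surface_axiom S -> axiom_code (map code S).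
Proof.
move=> sS; have aS := surface_axiom_atoms sS; have [ts eS] := atoms_of aS.
apply/orP; left; rewrite all_map (eq_all is_atom_codeE) aS /=.
rewrite eS in sS *; rewrite decode_atoms; apply/surface_testP; rewrite size_map.
exact: surface_axiom_table.
Qed.

Lemma axiom_code_relabel k t t' S : k \in relabellings -> relabelled k t t' ->
  perm_eq S [:: Atom t; Atom t'] -> axiom_code (map code S).
Proof.
move=> kr kt pS; apply/orP; right; apply/hasP; exists (code (Atom t)).
  by rewrite map_f // (perm_mem pS) mem_head.
apply/hasP; exists k => //; rewrite is_atom_codeE /=.
rewrite (iffRL (relabel_codeP _ _ (relabellings_lt6 kr)) kt).
exact: perm_map pS.
Qed.

Lemma inferred_mono s (T T' : seq (seq nat)) :
  {subset T <= T'} -> subpred (inferred s T) (inferred s T').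
Proof.
move=> sub u /orP[ax|/hasP[G GU /hasP[D DU H]]]; apply/orP; [by left|right].
apply/hasP; exists G => //; apply/hasP; exists D => //.
case/orP: H => [/and3P[/sub-> /sub-> ->]//|/hasP[p pF /hasP[q qF H]]].
apply/orP; right; apply/hasP; exists p => //; apply/hasP; exists q => //.
case/or3P: H => [/and4P[-> /sub-> /sub-> ->]|/and3P[/sub-> /sub-> ->]|/and3P[/sub-> /sub-> ->]];
  by rewrite ?orbT.
Qed.

Lemma ltn_code_seq c s : c \in s -> c < code_seq s.
Proof.
elim: s => //= a s IH; rewrite inE ltnS => /orP[/eqP ->|/IH/ltnW h].
  exact: leq_trans (leq_addr _ _) (leq_pairn _ _).
exact: leq_trans h (leq_trans (leq_addl _ _) (leq_pairn _ _)).
Qed.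

(** The inequality is strict because the tag of a compound code is at least 1 and adds to the two
    components. *)
Lemma ltn_children c d : d \in children c -> d < c.
Proof.
rewrite /children /is_atom_code; case: eqP => // /eqP; rewrite -lt0n => h.
have hc : fstn c + (fstn (sndn c) + sndn (sndn c)) <= c.
  rewrite -{4}(pairn_fst_snd c); apply: leq_trans (leq_pairn _ _).
  by rewrite leq_add2l -{3}(pairn_fst_snd (sndn c)) leq_pairn.
by rewrite !inE => /orP[] /eqP ->; lia.
Qed.

(** Codes in [s] are below [N], and each passage to a child lowers the code. Hence a code [x] that
    is reached at all is reached in some round [k] with [x + k < N], which leaves a further round
    for its children. *)
Lemma subformula_codes_children s c :
  c \in subformula_codes s -> {subset children c <= subformula_codes s}.
Proof.
rewrite /subformula_codes; set N := code_seq s; set f := fun l => _.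
have f_sub l : {subset l <= f l} by move=> x xl; rewrite mem_cat xl.
have iter_sub k d : {subset iter k f s <= iter (d + k) f s}.
  by elim: d => // d IH x /IH; exact: f_sub.
have early m x : x \in iter m f s -> exists2 k, x + k < N & x \in iter k f s.
  elim: m x => [|m IH] x; first by move=> xs; exists 0; rewrite ?addn0 ?ltn_code_seq.
  rewrite iterS mem_cat => /orP[/IH//|/flattenP[_ /mapP[y /IH[k yk yi] ->] xy]].
  exists k.+1; first by have := ltn_children xy; lia.
  by rewrite iterS mem_cat; apply/orP; right; apply/flattenP; exists (children y) => //; exact: map_f.
move=> /early[k ck ci] x xc; have kN : k.+1 <= N by lia.
rewrite -(subnK kN); apply: iter_sub.
by rewrite iterS mem_cat; apply/orP; right; apply/flattenP; exists (children c) => //; exact: map_f.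
Qed.

Section Universe.
Variable S0 : seq (formula W).
Let s0 := map code S0.

Lemma subformula_codes_code c : c \in subformula_codes s0 -> exists p, c = code p.
Proof.
rewrite /subformula_codes; elim: (code_seq _) c => [|k IH] c.
  by move=> /mapP[p _ ->]; exists p.
rewrite iterS mem_cat => /orP[/IH//|/flattenP[_ /mapP[d /IH[p ->] ->]]].
rewrite /children is_atom_codeE; case: p => [t|p q|p q] //=;
  by rewrite !sndnK fstnK !inE => /orP[] /eqP ->; [exists p | exists q].
Qed.

Lemma letters_of_pickle a : a \in letters_of s0 -> exists b : W, a = choice.pickle b.
Proof.
move=> /flattenP[_ /mapP[c + ->]]; rewrite mem_filter => /andP[ac /subformula_codes_code[p cp]].
rewrite {}cp in ac *; rewrite is_atom_codeE in ac; case: p ac => // t _.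
by rewrite decode_atom => /mapP[b _ ->]; exists b.
Qed.

Lemma formula_codes_code c : c \in formula_codes s0 -> exists p, c = code p.
Proof.
rewrite mem_cat => /orP[/subformula_codes_code//|/mapP[w +] ->].
rewrite mem_filter mem_lists_upto => /and3P[/andP[w6 wu] _ /allP wl].
have [w' ew] : exists w' : seq W, w = map choice.pickle w'.
  elim: w wl {w6 wu} => [|a w IH] wl; first by exists [::].
  have [b ->] := letters_of_pickle (wl a (mem_head _ _)).
  have [x xw|w' ->] := IH; first by apply: wl; rewrite inE xw orbT.
  by exists (b :: w').
have uw : uniq w.
  apply: count_mem_uniq => x; case xw : (x \in w); last by apply/count_memPn; rewrite xw.
  exact/eqP/(allP wu).
rewrite {}ew in w6 uw *; rewrite size_map in w6.
rewrite (map_inj_uniq (pcan_inj choice.pickleK)) in uw.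
by exists (Atom (exist _ (Tuple w6) uw)).
Qed.

Lemma compound_codes p : ~~ is_atom p -> code p \in formula_codes s0 ->
  {subset children (code p) <= formula_codes s0}.
Proof.
move=> np; rewrite mem_cat => /orP[h x /(subformula_codes_children h) xs|].
  by rewrite mem_cat xs.
by case: p np => [//|p q|p q] _ /mapP[w _] /pairn_inj[].
Qed.

Lemma dia_codes p q : code (Dia p q) \in formula_codes s0 ->
  code p \in formula_codes s0 /\ code q \in formula_codes s0.
Proof.
move=> /compound_codes h; split; apply: h => //;
  by rewrite /children is_atom_codeE /= !sndnK fstnK !inE eqxx ?orbT.
Qed.

Lemma iff_codes p q : code (Iff p q) \in formula_codes s0 ->
  code p \in formula_codes s0 /\ code q \in formula_codes s0.
Proof.
move=> /compound_codes h; split; apply: h => //;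
  by rewrite /children is_atom_codeE /= !sndnK fstnK !inE eqxx ?orbT.
Qed.

Lemma letters_in_universe p a : code p \in formula_codes s0 -> a \in formula_letters p ->
  choice.pickle a \in letters_of s0.
Proof.
elim: p => [t|p IHp q IHq|p IHp q IHq].
- rewrite mem_cat => /orP[ts|/mapP[w + /pairn_inj[_ /code_seq_inj ew]]] /= at_.
    apply/flattenP; exists (decode (sndn (code (Atom t)))).
      by apply/mapP; exists (code (Atom t)); rewrite // mem_filter is_atom_codeE.
    by rewrite decode_atom map_f.
  rewrite mem_filter mem_lists_upto => /and3P[_ _ /allP]; apply.
  by rewrite -ew map_f.
- by move=> /dia_codes[/IHp hp /IHq hq] /=; rewrite mem_cat => /orP[].
- by move=> /iff_codes[/IHp hp /IHq hq] /=; rewrite mem_cat => /orP[].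
Qed.

Lemma atom_in_universe t :
  (forall a, a \in tval (val t) -> choice.pickle a \in letters_of s0) ->
  code (Atom t) \in formula_codes s0.
Proof.
move=> H; rewrite mem_cat code_atom; apply/orP; right; apply/map_f.
rewrite mem_filter mem_lists_upto !size_map !size_sextuple /=; apply/andP; split.
  apply/allP => b bt; rewrite (count_uniq_mem b) ?bt //.
  by rewrite (map_inj_uniq (pcan_inj choice.pickleK)); exact: (valP t).
by apply/allP => b /mapP[a /H + ->].
Qed.

Local Notation stage k := (iter k (saturation_step s0) [::]).

Lemma sequent_codes_code u : u \in sequent_codes s0 -> exists S, u = map code S.
Proof.
rewrite mem_lists_upto => /andP[_]; elim: u => [|c u IH] /=; first by exists [::].
move=> /andP[/formula_codes_code[p ->] /IH[S ->]]; by exists (p :: S).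
Qed.

Lemma stage_sound k u : u \in stage k -> exists2 S, u = map code S & nd S.
Proof.
elim: k u => // k IH u; rewrite iterS mem_filter => /andP[+ uU].
have [S ->] := sequent_codes_code uU => H; exists S => //.
case/orP: H => [/axiom_code_sound//|/hasP[G /sequent_codes_code[G' ->]]].
move=> /hasP[D /sequent_codes_code[D' ->]].
have nd_stage S' : map code S' \in stage k -> nd S'.
  by move=> /IH[S'' /(inj_map code_formula_inj) <-].
have pcat S' : perm_eq (map code S) (map code S') -> perm_eq S S'.
  exact: (perm_map_inj code_formula_inj).
case/orP => [/and3P[/nd_stage nG /nd_stage nD]|].
  by rewrite -map_cat => /pcat; exact: nd_mix.
move=> /hasP[_ /formula_codes_code[p ->] /hasP[_ /formula_codes_code[q ->]]].
case/or3P.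
- rewrite is_atom_codeE => /and4P[ap]; case: p ap => // t _.
  move=> /(nd_stage (Atom t :: G')) nG /(nd_stage (Atom t :: D')) nD.
  by rewrite -map_cat => /pcat; exact: nd_cut nG nD.
- move=> /and3P[/(nd_stage (p :: G')) nG /(nd_stage (q :: G')) nD].
  by move=> /(pcat (Dia p q :: G')); exact: nd_dia nG nD.
- move=> /and3P[/(nd_stage (p :: G')) nG /(nd_stage (q :: D')) nD].
  by rewrite -map_cat => /(pcat (Iff p q :: G' ++ D')); exact: nd_iff nG nD.
Qed.

Lemma nd_letter_other p S a : nd (p :: S) -> a \in formula_letters p ->
  exists2 q, q \in S & a \in formula_letters q.
Proof.
by move=> /(nd_letters a) /= + ap; rewrite ap -lt0n -has_count => /hasP[q]; exists q.
Qed.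

(** This bounds the length of sequents: with nonempty contexts, neither premise of an atomic cut is
    longer than the conclusion. *)
Lemma nd_cons_atom_nonempty t S : nd (Atom t :: S) -> 0 < size S.
Proof.
move=> nS; have [a at_] : exists a, a \in tval (val t).
  by have := size_sextuple t; case: (tval (val t)) => // a w _; exists a; rewrite mem_head.
by have [q] := nd_letter_other nS at_; case: (S).
Qed.

Lemma mem_sequent_codes S : (forall p, p \in S -> code p \in formula_codes s0) ->
  size S <= size s0 -> map code S \in sequent_codes s0.
Proof.
move=> H sS; rewrite mem_lists_upto size_map sS /=.
by apply/allP => _ /mapP[p /H + ->].
Qed.

Lemma nd_stage S : nd S -> (forall p, p \in S -> code p \in formula_codes s0) ->
  size S <= size s0 -> exists k, map code S \in stage k.
Proof.
have pcode S1 S2 : perm_eq S1 S2 -> perm_eq (map code S1) (map code S2) by exact: perm_map.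
have lift2 S1 S2 : (exists k, map code S1 \in stage k) -> (exists k, map code S2 \in stage k) ->
    exists k, map code S1 \in stage k /\ map code S2 \in stage k.
  move=> [k1 h1] [k2 h2]; exists (maxn k1 k2).
  by split; [apply: stage_leq h1 | apply: stage_leq h2] => //;
    [exact: inferred_mono | exact: leq_maxl | exact: inferred_mono | exact: leq_maxr].
have next S' k : (forall p, p \in S' -> code p \in formula_codes s0) -> size S' <= size s0 ->
    inferred s0 (stage k) (map code S') -> exists k, map code S' \in stage k.
  by move=> H sS' inf; exists k.+1; rewrite iterS mem_filter inf mem_sequent_codes.
elim=> {S}.
- move=> u su H sz; apply: (next _ 0) => //; apply/orP; left; exact: axiom_code_surface.
- move=> k t t' u kr kt pu H sz; apply: (next _ 0) => //; apply/orP; left.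
  exact: axiom_code_relabel kr kt pu.
- move=> G D t u nG IHG nD IHD pu H sz.
  have HG p : p \in G -> code p \in formula_codes s0.
    by move=> pG; apply: H; rewrite (perm_mem pu) mem_cat pG.
  have HD p : p \in D -> code p \in formula_codes s0.
    by move=> pD; apply: H; rewrite (perm_mem pu) mem_cat pD orbT.
  have sz' : size G + size D <= size s0 by rewrite -size_cat -(perm_size pu).
  have sG := nd_cons_atom_nonempty nG; have sD := nd_cons_atom_nonempty nD.
  (* Every letter of the cut atom recurs in a formula of [G], hence in the conclusion, so the atom
     is among those formed from the available letters. *)
  have Ht : code (Atom t) \in formula_codes s0.
    apply: atom_in_universe => a /(nd_letter_other nG)[q qG].
    by apply: letters_in_universe; exact: HG.
  have [k [kG kD]] : exists k, map code (Atom t :: G) \in stage k /\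
      map code (Atom t :: D) \in stage k.
    apply: lift2; [apply: IHG | apply: IHD]; try (by move=> p; rewrite inE => /orP[/eqP ->|]; auto);
      by rewrite /=; lia.
  apply: (next _ k) => //; apply/orP; right.
  apply/hasP; exists (map code G); first by apply: mem_sequent_codes => //; lia.
  apply/hasP; exists (map code D); first by apply: mem_sequent_codes => //; lia.
  apply/orP; right; apply/hasP; exists (code (Atom t)) => //.
  apply/hasP; exists (code (Atom t)) => //; apply/or3P; apply: Or31.
  by rewrite is_atom_codeE kG kD -map_cat pcode.
- move=> G D u nG IHG nD IHD pu H sz.
  have HG p : p \in G -> code p \in formula_codes s0.
    by move=> pG; apply: H; rewrite (perm_mem pu) mem_cat pG.
  have HD p : p \in D -> code p \in formula_codes s0.
    by move=> pD; apply: H; rewrite (perm_mem pu) mem_cat pD orbT.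
  have sz' : size G + size D <= size s0 by rewrite -size_cat -(perm_size pu).
  have [k [kG kD]] : exists k, map code G \in stage k /\ map code D \in stage k.
    by apply: lift2; [apply: IHG | apply: IHD] => //; lia.
  apply: (next _ k) => //; apply/orP; right.
  apply/hasP; exists (map code G); first by apply: mem_sequent_codes => //; lia.
  apply/hasP; exists (map code D); first by apply: mem_sequent_codes => //; lia.
  by apply/orP; left; rewrite kG kD -map_cat pcode.
- move=> G p q u nG IHG nD IHD pu H sz.
  have HG r : r \in G -> code r \in formula_codes s0.
    by move=> pG; apply: H; rewrite (perm_mem pu) inE pG orbT.
  have [Hp Hq] : code p \in formula_codes s0 /\ code q \in formula_codes s0.
    by apply: dia_codes; apply: H; rewrite (perm_mem pu) mem_head.
  have sz' : (size G).+1 <= size s0 by rewrite -[(size G).+1]/(size (Dia p q :: G)) -(perm_size pu).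
  have [k [kG kD]] : exists k, map code (p :: G) \in stage k /\ map code (q :: G) \in stage k.
    by apply: lift2; [apply: IHG | apply: IHD] => // r; rewrite inE => /orP[/eqP ->|]; auto.
  apply: (next _ k) => //; apply/orP; right.
  have GU : map code G \in sequent_codes s0 by apply: mem_sequent_codes => //; lia.
  (* [inferred] searches for two contexts; the premises of [nd_dia] share one, which is supplied
     twice. *)
  apply/hasP; exists (map code G) => //; apply/hasP; exists (map code G) => //.
  apply/orP; right; apply/hasP; exists (code p) => //; apply/hasP; exists (code q) => //.
  by apply/or3P; apply: Or32; rewrite kG kD; exact: (pcode _ (Dia p q :: G)).
- move=> G D p q u nG IHG nD IHD pu H sz.
  have HG r : r \in G -> code r \in formula_codes s0.
    by move=> pG; apply: H; rewrite (perm_mem pu) inE mem_cat pG orbT.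
  have HD r : r \in D -> code r \in formula_codes s0.
    by move=> pD; apply: H; rewrite (perm_mem pu) inE mem_cat pD !orbT.
  have [Hp Hq] : code p \in formula_codes s0 /\ code q \in formula_codes s0.
    by apply: iff_codes; apply: H; rewrite (perm_mem pu) mem_head.
  have sz' : (size G + size D).+1 <= size s0.
    by rewrite -size_cat -[_.+1]/(size (Iff p q :: G ++ D)) -(perm_size pu).
  have [k [kG kD]] : exists k, map code (p :: G) \in stage k /\ map code (q :: D) \in stage k.
    apply: lift2; [apply: IHG | apply: IHD]; try (by move=> r; rewrite inE => /orP[/eqP ->|]; auto);
      by rewrite /=; lia.
  apply: (next _ k) => //; apply/orP; right.
  apply/hasP; exists (map code G); first by apply: mem_sequent_codes => //; lia.
  apply/hasP; exists (map code D); first by apply: mem_sequent_codes => //; lia.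
  apply/orP; right; apply/hasP; exists (code p) => //; apply/hasP; exists (code q) => //.
  apply/or3P; apply: Or33; rewrite kG kD -map_cat; exact: (pcode _ (Iff p q :: G ++ D)).
Qed.

Lemma decideP : decide s0 <-> nd S0.
Proof.
split=> [/stage_sound[S /(inj_map code_formula_inj) ->//]|n0].
have [||k] := nd_stage n0; rewrite ?size_map //.
  move=> p pS; rewrite mem_cat; apply/orP; left; rewrite /subformula_codes.
  elim: (code_seq _) => [|k IH]; first exact: map_f.
  by rewrite iterS mem_cat IH.
by move=> /stage_sat; apply; exact: inferred_mono.
Qed.

End Universe.

End Correctness.

Theorem proposition9p1 (W : countType) :
  exists2 f : nat -> nat, recursive f &
    forall s : seq (formula W),
      (f (code_sequent s) = 1 /\ derivable (seq_mset s)) \/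
      (f (code_sequent s) = 0 /\ ~ derivable (seq_mset s)).
Proof.
have [f rf hf] := computable_decide; exists f => // s.
(* As a number, the code of a sequent is the code of the list of the codes of its formulae, on which
   [decide] works. *)
have -> : f (code_sequent s) = decide [seq code_formula p | p <- s].
  have := hf [seq code_formula p | p <- s].
  by rewrite [enc (map _ _)]/= map_id.
case: (boolP (decide _)) => [/decideP h|/negP h]; [left|right]; split=> //.
  exact: nd_derivable.
by move=> /derivable_nd ns; apply/h/decideP.
Qed.
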